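(* Let $n\ge 2$, $I=(i_\nu)_{\nu=0}^{n-2}\in\mathcal I_n$, $\Sigma=(\sigma_\nu)_{\nu=0}^{n-2}\in\Sigma_{I,loc}$ and $F=\mathscr F_I(\Sigma)=[f_{k,j}]_{k,j=1}^n$. Let the quasi-derivatives be defined by $$y^{[0]}:=y,\qquad y^{[k]}:=(y^{[k-1]})'-\sum_{j=1}^{k}f_{k,j}\,y^{[j-1]},\quad k=1,\dots,n,$$ and let $$\mathcal D_F:=\{y\colon y^{[k]}\in AC_{loc}(\mathbb R_+),\ k=0,\dots,n-1\}.$$ Then, for any $y\in\mathcal D_F$, one has $\ell_n(y)\in L_{1,loc}(\mathbb R_+)$ and $\ell_n(y)=y^{[n]}$.
   Context: Notation: $\mathbb R_+=(0,\infty)$; $n=2m+\tau$ with $m\in\mathbb N$, $\tau\in\{0,1\}$; $C_i^s=\frac{i!}{s!(i-s)!}$ are the binomial coefficients, with $C_i^{-1}:=0$. Singularity orders: $\mathcal I_n$ is the set of integer sequences $I=(i_\nu)_{\nu=0}^{n-2}$ with $0\le i_{2k}\le m-k$ for $k=0,\dots,m-1$ and $0\le i_{2k+1}\le m-k-1$ for $k=0,\dots,m+\tau-2$. The set $K(I)\subseteq\{0,\dots,n-2\}$: if $n=2m+1$, then $K(I)=\varnothing$; if $n=2m$, then $2k\in K(I)\Leftrightarrow i_{2k}=m-k$, and $2k+1\in K(I)\Leftrightarrow i_{2k+1}=m-k-1$. Coefficients: $\Sigma_{I,loc}$ is the set of $\Sigma=(\sigma_\nu)_{\nu=0}^{n-2}$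 with $\sigma_\nu\in L_{1,loc}(\mathbb R_+)$ for all $\nu=0,\dots,n-2$ and, in addition, $\sigma_\nu\in L_{2,loc}(\mathbb R_+)$ for $\nu\in K(I)$. Differential expression (derivatives in the sense of distributions on $\mathbb R_+$; $\mathfrak D'$ denotes the dual of $\mathfrak D=C_0^\infty(\mathbb R_+)$): $$\ell_n(y):=y^{(n)}+\sum_{k=0}^{m-1}(-1)^{i_{2k}+k}\bigl(\sigma_{2k}^{(i_{2k})}y^{(k)}\bigr)^{(k)}+\sum_{k=0}^{m+\tau-2}(-1)^{i_{2k+1}+k+1}\Bigl[\bigl(\sigma_{2k+1}^{(i_{2k+1})}y^{(k)}\bigr)^{(k+1)}+\bigl(\sigma_{2k+1}^{(i_{2k+1})}y^{(k+1)}\bigr)^{(k)}\Bigr].$$ The products are understood via the formal Leibniz rules $\bigl(\sigma^{(i)}y^{(k)}\bigr)^{(k)}=\sum_{s=0}^i(-1)^sC_i^s(\sigma y^{(s+k)})^{(i-s+k)}$ and $\bigl(\sigma^{(i)}y^{(k)}\bigr)^{(k+1)}+\bigl(\sigma^{(i)}y^{(k+1)}\bigr)^{(k)}=\sum_{s=0}^{i+1}(-1)^s(C_{i+1}^s-2C_i^{s-1})(\sigma y^{(s+k)})^{(i+1-s+k)}$. Matrix $Q$: $\mathscr Q_I(\Sigma)=[q_{r,j}]_{r,j=0}^m:=\sum_{\nu=0}^{n-2}\sigma_\nu(x)\chi_{\nu,i_\nu}$, where the constant matrices $\chi_{\nu,i}=[\chi_{\nu,i;r,j}]_{r,j=0}^m$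 have entries $\chi_{2k,i;s+k,i-s+k}=C_i^s$ $(s=0,\dots,i)$, $\chi_{2k+1,i;s+k,i+1-s+k}=C_{i+1}^s-2C_i^{s-1}$ $(s=0,\dots,i+1)$, and all other entries zero. Matrix $F$: $\mathscr F_I(\Sigma)=\mathscr S_n(\mathscr Q_I(\Sigma))$, where $F=[f_{k,j}]_{k,j=1}^n=\mathscr S_n(Q)$ is given as follows. If $n=2m$: $f_{m,j}=(-1)^{m+1}q_{j-1,m}$ for $1\le j\le m$; $f_{k,m+1}=(-1)^{k+1}q_{m,2m-k}$ for $m+1\le k\le 2m$; $f_{k,j}=(-1)^{k+1}q_{j-1,2m-k}+(-1)^{m+k}q_{j-1,m}q_{m,2m-k}$ for $m+1\le k\le 2m$, $1\le j\le m$. If $n=2m+1$: $f_{k,j}=(-1)^kq_{j-1,2m+1-k}$ for $m+1\le k\le 2m+1$, $1\le j\le m+1$. In both cases $f_{k,k+1}=1$ for $k=1,\dots,n-1$, and all remaining entries are zero. *)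

(* Defs.v *)
From HB Require Import structures.
From mathcomp Require Import all_boot all_order all_algebra.
From mathcomp Require Import complex.
From mathcomp Require Import all_classical all_reals all_analysis.

Set Implicit Arguments.
Unset Strict Implicit.
Unset Printing Implicit Defensive.

Import Order.TTheory GRing.Theory Num.Theory.
Import numFieldNormedType.Exports.

Local Open Scope classical_set_scope.
Local Open Scope ring_scope.
Local Open Scope complex_scope.

(* All functions on R_+ = ]0, +oo[ are complex-valued, and are represented by
   total functions R -> R[i] whose values outside ]0, +oo[ never matter.
   Derivatives, integrals, absolute continuity and local integrability of
   complex-valued functions are componentwise. *)

Section functions_on_the_half_line.
Context {R : realType}.
Implicit Types (f g y : R -> R[i]) (h : R -> R).

Definition Rplus : set R := `]0, +oo[%classic.

Definition ReF f : R -> R := fun x => complex.Re (f x).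
Definition ImF f : R -> R := fun x => complex.Im (f x).

Definition cderive (k : nat) f : R -> R[i] :=
  fun x => derive1n k (ReF f) x +i* derive1n k (ImF f) x.

Definition cintegral f : R[i] :=
  Rintegral lebesgue_measure Rplus (ReF f)
    +i* Rintegral lebesgue_measure Rplus (ImF f).

Definition ae_eq_on_Rplus f g : Prop :=
  {ae (@lebesgue_measure R), forall x, 0 < x -> f x = g x}.

Definition abs_continuous (a b : R) h : Prop :=
  forall e : R, 0 < e -> exists2 d : R, 0 < d &
    forall (N : nat) (u v : 'I_N -> R),
      (forall i, [/\ a <= u i, u i <= v i & v i <= b]) ->
      trivIset setT (fun i => `]u i, v i[%classic) ->
      \sum_(i < N) (v i - u i) < d ->
      \sum_(i < N) `|h (v i) - h (u i)| < e.

Definition AC_loc f : Prop :=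
  forall a b : R, 0 < a -> a <= b ->
    abs_continuous a b (ReF f) /\ abs_continuous a b (ImF f).

(* As usual for Lebesgue classes, an element of L_{p,loc} is given by a
   measurable representative. *)
Definition L1_loc f : Prop :=
  locally_integrable Rplus (ReF f) /\ locally_integrable Rplus (ImF f).

Definition L2_loc f : Prop :=
  [/\ measurable_fun Rplus (ReF f), measurable_fun Rplus (ImF f),
      locally_integrable Rplus (fun x => ReF f x ^+ 2)
    & locally_integrable Rplus (fun x => ImF f x ^+ 2)].

End functions_on_the_half_line.

Section distributions.
Context {R : realType}.
Implicit Types (f g y sigma phi : R -> R[i]).

Definition test_function phi : Prop :=
  (forall (k : nat) (x : R), derivable (derive1n k (ReF phi)) x 1 /\
                             derivable (derive1n k (ImF phi)) x 1) /\
  (exists a b : R, [/\ 0 < a, a <= b &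
     forall x, ~ (a <= x <= b) -> phi x = 0]).

(* A distribution is a functional which is only ever evaluated at test
   functions.  Continuity is not bundled: the distributions below are finite
   combinations of derivatives of locally integrable functions, for which it
   is automatic. *)
Definition functional : Type := (R -> R[i]) -> R[i].
Implicit Type T : functional.

Definition regular f : functional := fun phi => cintegral (fun x => f x * phi x).

Definition has_density T f : Prop :=
  L1_loc f /\ forall phi, test_function phi -> T phi = regular f phi.

Definition dist_derive (k : nat) T : functional :=
  fun phi => (-1) ^+ k * T (cderive k phi).

(* The function a regular distribution is identified with; it is unique up to
   a.e. equality, and 0 is a dummy value for non-regular distributions. *)
Definition density T : R -> R[i] := xget (fun=> 0) [set g | has_density T g].

Definition dist_mul sigma T : functional :=
  regular (fun x => sigma x * density T x).

End distributions.

(* For n = 2 m + tau, m is n./2 and tau is odd n.  A sequence indexed by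
   nu = 0, ..., n - 2 is a function on nat that is only used at nu < n.-1. *)

Section singular_coefficients.
Context {R : realType}.
Implicit Types (n m k i s nu : nat) (I : nat -> nat).
Implicit Types (Sigma : nat -> R -> R[i]) (y : R -> R[i]).

Definition singularity_orders n I : Prop :=
  (forall k, (k < n./2)%N -> (I k.*2 <= n./2 - k)%N) /\
  (forall k, (k < (n./2 + odd n).-1)%N -> (I k.*2.+1 <= n./2 - k - 1)%N).

Definition in_K n I nu : bool :=
  [&& ~~ odd n, (nu < n.-1)%N &
      I nu == (if odd nu then n./2 - nu./2 - 1 else n./2 - nu./2)%N].

Definition Sigma_loc n I Sigma : Prop :=
  forall nu, (nu < n.-1)%N ->
    L1_loc (Sigma nu) /\ (in_K n I nu -> L2_loc (Sigma nu)).

(* C_i^s *)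
Definition coef_even i s : R[i] := 'C(i, s)%:R.

(* C_{i+1}^s - 2 C_i^{s-1}, with C_i^{-1} = 0 *)
Definition coef_odd i s : R[i] :=
  'C(i.+1, s)%:R - 2 * (if s is s'.+1 then 'C(i, s') else 0%N)%:R.

(* (sigma^(i) T^(k))^(k) *)
Definition leibniz_even (sigma : R -> R[i]) i k (T : functional) : functional :=
  fun phi => \sum_(s < i.+1) (-1) ^+ s * coef_even i s *
    dist_derive (i - s + k) (dist_mul sigma (dist_derive (s + k) T)) phi.

(* (sigma^(i) T^(k))^(k+1) + (sigma^(i) T^(k+1))^(k) *)
Definition leibniz_odd (sigma : R -> R[i]) i k (T : functional) : functional :=
  fun phi => \sum_(s < i.+2) (-1) ^+ s * coef_odd i s *
    dist_derive (i.+1 - s + k) (dist_mul sigma (dist_derive (s + k) T)) phi.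

Definition ell n I Sigma y : functional := fun phi =>
  dist_derive n (regular y) phi
  + \sum_(k < n./2) (-1) ^+ (I k.*2 + k) *
      leibniz_even (Sigma k.*2) (I k.*2) k (regular y) phi
  + \sum_(k < (n./2 + odd n).-1) (-1) ^+ (I k.*2.+1 + k + 1) *
      leibniz_odd (Sigma k.*2.+1) (I k.*2.+1) k (regular y) phi.

(* For each entry (r, j) at most one s contributes to the sums below. *)
Definition chi m nu i : 'M[R[i]]_m.+1 :=
  \matrix_(r, j)
    (let k := nu./2 in
     if odd nu then
       \sum_(s < i.+2 | (r == s + k :> nat)%N && (j == i.+1 - s + k :> nat)%N)
         coef_odd i s
     else
       \sum_(s < i.+1 | (r == s + k :> nat)%N && (j == i - s + k :> nat)%N)
         coef_even i s).

Definition Qmatrix n I Sigma (x : R) : 'M[R[i]]_((n./2).+1) :=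
  \sum_(nu < n.-1) Sigma nu x *: chi n./2 nu (I nu).

(* The rows and columns of F are numbered from 1, those of Q from 0. *)
Definition Smap n (Q : 'M[R[i]]_((n./2).+1)) : 'M[R[i]]_n :=
  let m := n./2 in
  let q (r j : nat) := Q (inord r) (inord j) in
  \matrix_(a, b)
    (let k := a.+1 in let j := b.+1 in
     if j == k.+1 then 1
     else if odd n then
       if (m < k)%N && (j <= m.+1)%N then (-1) ^+ k * q j.-1 (n - k)%N else 0
     else
       if (k == m) && (j <= m)%N then (-1) ^+ m.+1 * q j.-1 m
       else if (m < k)%N && (j == m.+1) then (-1) ^+ k.+1 * q m (n - k)%N
       else if (m < k)%N && (j <= m)%N then
         (-1) ^+ k.+1 * q j.-1 (n - k)%N
         + (-1) ^+ (m + k) * q j.-1 m * q m (n - k)%N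
       else 0).

Definition Fmatrix n I Sigma (x : R) : 'M[R[i]]_n := Smap (Qmatrix n I Sigma x).

(* Y k represents y^[k] for k = 0, ..., n.  For 0 < k the function y^[k] is
   only defined up to a.e. equality, and the representatives are required to
   be locally absolutely continuous for k < n; Y n is an arbitrary
   representative.  The derivative of Y k is taken pointwise a.e. *)
Definition AC_quasi_derivatives n (F : R -> 'M[R[i]]_n) y
    (Y : nat -> R -> R[i]) : Prop :=
  [/\ Y 0%N = y,
      forall k : 'I_n, ae_eq_on_Rplus (Y k.+1)
        (fun x => cderive 1 (Y k) x
                  - \sum_(j < n | (j <= k)%N) F x k j * Y j x)
    & forall k, (k < n)%N -> AC_loc (Y k)].

Definition domain n (F : R -> 'M[R[i]]_n) : set (R -> R[i]) :=
  [set y | exists Y, AC_quasi_derivatives F y Y].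

End singular_coefficients.

(* Main.v *)
Require Import Defs.
From HB Require Import structures.
From mathcomp Require Import all_boot all_order all_algebra.
From mathcomp Require Import complex.
From mathcomp Require Import all_classical all_reals all_analysis.
From mathcomp Require Import measurable_realfun.
From mathcomp Require Import zify lra ring.

Set Implicit Arguments.
Unset Strict Implicit.
Unset Printing Implicit Defensive.
Import Order.TTheory GRing.Theory Num.Theory.
Import numFieldNormedType.Exports.

Local Open Scope classical_set_scope.
Local Open Scope ring_scope.

(** Write D for the distributional derivative and m for the integer half of
    n.  Expanding the Leibniz rules, every term of the differential expression
    has the form (-1)^r D^r (c sigma_nu D^j y), where c is one of the constants
    that define the matrices chi; collecting the terms with the same r gives

      ell(y) = D^n y + sum over r of (-1)^r D^r (V_r),
      V_r = sum over j <= m of q_{j,r} D^j y   (V_r = 0 for r > m).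

    The matrix F is built so that the quasi-derivatives run through this sum
    as a Horner scheme: y^[k+1] = D y^[k] + (-1)^r V_r with r = n-k-1.  For odd
    n, and for even n when k+1 <= m, this is read off the entries of F; for
    even n and larger k the product q_{j,m} q_{m,r} in F is what remains after
    D^m y has been replaced by y^[m] - (-1)^m sum_{j<m} q_{j,m} D^j y, the
    function denoted u_m below.  This is [row_identity].  Moving the derivatives
    one after the other to the test function yields ell(y) = y^[n].

    Two facts make the computation meaningful.  The products sigma_nu D^j y are
    locally integrable: for j < m, and for j = m with odd n, D^j y is locally
    absolutely continuous; for even n the function D^m y is only locally square
    integrable, but it is multiplied only by coefficients with nu in K(I), which
    are locally square integrable too ([coef_deriv_L1]).  And the a.e. derivative
    of a locally absolutely continuous function is its distributional
    derivative ([AC_loc_density]), whereas a distribution has at most one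
    density ([has_density_unique]), so that the density chosen in a product
    sigma T may be replaced by u_j.

    These two analytic facts are proved from measure theory.  An absolutely
    continuous h is the difference of two nondecreasing functions with small
    increments, its total variation and the total variation minus h; their
    Lebesgue-Stieltjes measures are dominated by Lebesgue measure, so the
    Radon-Nikodym theorem writes h as an indefinite integral
    ([abs_continuous_density]), and the Lebesgue differentiation theorem
    identifies the integrand with h'.  Integration by parts against a test
    function phi is this formula for h phi.  For uniqueness, the smooth functions
    1 - exp (- n beta), with beta positive exactly on ]c, d[, increase to the
    indicator of ]c, d[; a function orthogonal to all test functions thus has
    integral 0 over every interval and vanishes a.e. by differentiation
    ([fundamental_lemma]). *)

(** * Nondecreasing functions with small increments are indefinite integrals *)

Section cumulative_density.
Context {R : realType}.
Notation mu := (@lebesgue_measure R).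

Definition nonoverlapping (p q : R * R) := (p.2 <= q.1) || (q.2 <= p.1).

Lemma open_interval_itv (J : set R) (c d : R) :
  open J -> is_interval J -> J !=set0 -> J `<=` `]c, d[%classic ->
  exists u v, u < v /\ J = `]u, v[%classic.
Proof.
move=> oJ /is_intervalP JE [x Jx] Jcd.
have nbd (y : R) : J y -> exists2 e : R, 0 < e & J (y - e) /\ J (y + e).
  move=> Jy; have /nbhs_ballP[e /= e0 be] : nbhs y J by exact: open_nbhs_nbhs.
  exists (e / 2); first by rewrite divr_gt0.
  have e2 : `|e / 2| < e by rewrite gtr0_norm ?divr_gt0// ltr_pdivrMr// ltr_pMr// ltr1n.
  split; apply: be; rewrite /ball/=.
    by rewrite opprB addrC subrK.
  by rewrite opprD addrA subrr sub0r normrN.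
have nJx y : y <= c \/ d <= y -> ~ J y.
  by case=> h /Jcd; rewrite /= in_itv/= => /andP[]; rewrite !ltNge h.
move: JE Jx; case: (Rhull J) => [[bl u|[]] [br v|[]]] JE Jx;
  have := Jx; rewrite {1}JE /=; do ?by rewrite in_itv/= ?andbF.
- move=> xI; exists u, v.
  have uNJ : ~ J u.
    move=> Ju; have [e e0 [+ _]] := nbd _ Ju.
    by rewrite JE /= in_itv/= => /andP[+ _]; case: (bl) => /=;
      [rewrite lerBrDr gerDl leNgt e0|rewrite ltrBrDr gtrDl (lt_gtF e0)].
  have vNJ : ~ J v.
    move=> Jv; have [e e0 [_ +]] := nbd _ Jv.
    by rewrite JE /= in_itv/= => /andP[_ +]; case: (br) => /=;
      [rewrite gtrDl (lt_gtF e0)|rewrite gerDl leNgt e0].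
  have JE' : J = `]u, v[%classic.
    rewrite JE; apply/seteqP; split => y.
      move=> /= yI; have Jy : J y by rewrite JE.
      have yu : y != u by apply/eqP => yu; apply: uNJ; rewrite -yu.
      have yv : y != v by apply/eqP => yv; apply: vNJ; rewrite -yv.
      move: yI; rewrite !in_itv/= => /andP[h1 h2].
      by rewrite !lt_neqAle yv (eq_sym u) yu /= (lteifW h1) (lteifW h2).
    rewrite /= !in_itv/= => /andP[h1 h2].
    by case: (bl); case: (br); rewrite /= ?h1 ?h2 ?(ltW h1) ?(ltW h2).
  have : J x by [].
  rewrite JE' /= in_itv/= => /andP[xu xv].
  by split => //; exact: lt_trans xv.
- rewrite in_itv/= andbT => ux; exfalso; apply: (nJx (Num.max x d)).
    by right; rewrite le_max lexx orbT.
  by rewrite JE /= in_itv/= andbT; move: ux; case: (bl) => /= ux; rewrite ?le_max ?lt_max ux.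
- rewrite in_itv/= => xv; exfalso; apply: (nJx (Num.min x c)).
    by left; rewrite ge_min lexx orbT.
  by rewrite JE /= in_itv/=; move: xv; case: (br) => /= xv; rewrite ?ge_min ?gt_min xv.
- move=> _; exfalso; apply: (nJx c); first by left.
  by rewrite JE /= in_itv.
Qed.

Lemma lebesgue_stieltjes_itv (G : cumulative R R) (u v : R) : u <= v ->
  lebesgue_stieltjes_measure G `]u, v]%classic = (G v - G u)%:E.
Proof.
move=> uv; rewrite /lebesgue_stieltjes_measure /measure_extension.
by rewrite measurable_mu_extE/=; [rewrite wlength_itv_bnd|exact: is_ocitv].
Qed.

(** Families are lists, not indexed by ordinals, so that an interval can be replaced
    by the intervals of a subdivision. *)
Definition increments_le (G : R -> R) (d e : R) := forall l : seq (R * R),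
  (forall p, p \in l -> p.1 <= p.2) -> pairwise nonoverlapping l ->
  \sum_(p <- l) (p.2 - p.1) < d -> \sum_(p <- l) (G p.2 - G p.1) <= e.

Definition small_increments (G : R -> R) :=
  forall e : R, 0 < e -> exists2 d : R, 0 < d & increments_le G d e.

Lemma nneseries_le (f : nat -> \bar R) (P : pred nat) (M : \bar R) :
  (forall n, (0 <= f n)%E) -> (forall N, (\sum_(0 <= n < N | P n) f n <= M)%E) ->
  (\sum_(0 <= n <oo | P n) f n <= M)%E.
Proof.
move=> f0 fM; apply: lime_le; first by apply: is_cvg_nneseries.
exact: nearW.
Qed.

(** An open set is a countable disjoint union of open intervals; bounding the finite
    partial sums is enough, and these are families of nonoverlapping intervals. *)
Lemma cumulative_open_le (G : cumulative R R) (e d : R) (a b : R) (U : set R) :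
  increments_le G d e ->
  open U -> U `<=` `]a, b[%classic -> (mu U < d%:E)%E ->
  (lebesgue_stieltjes_measure G U <= e%:E)%E.
Proof.
move=> Gd oU Uab mUd.
have [J [oJ tJ UJ]] : exists J : nat -> set R,
    [/\ forall q, open (J q) /\ is_interval (J q), trivIset setT J &
        U = \bigcup_q J q].
  exists (open_disjoint_itv oU); split.
  - by move=> q; split; [exact: open_disjoint_itv_open|exact: open_disjoint_itv_is_interval].
  - exact: open_disjoint_itv_trivIset.
  - exact: open_disjoint_itv_bigcup.
have mJ n : measurable (J n) by apply: open_measurable; case: (oJ n).
have JU n : J n `<=` U by rewrite UJ; exact: bigcup_sup.
have /choice[uv uvP] : forall n, exists uv : R * R,
    J n !=set0 -> uv.1 < uv.2 /\ J n = `]uv.1, uv.2[%classic.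
  move=> n.
  have [J0|J0] := pselect (J n !=set0); last by exists (0, 0).
  have [oJn iJn] := oJ n.
  have [u [v h]] := open_interval_itv oJn iJn J0 (subset_trans (JU n) Uab).
  by exists (u, v).
rewrite [in leLHS]UJ.
pose sel N := [seq n <- iota 0 N | `[< J n !=set0 >]].
have selS (f : nat -> \bar R) N : (forall n, J n = set0 -> f n = 0%E) ->
    (\sum_(0 <= n < N | n \in setT) f n = \sum_(n <- sel N) f n)%E.
  move=> f0; rewrite /sel big_filter /index_iota subn0.
  rewrite [RHS]big_mkcond/= [LHS](eq_bigl xpredT) => [|i]; last by rewrite in_setT.
  apply: eq_bigr => n _; case: asboolP => //.
  by move=> /set0P/negP; rewrite negbK => /eqP /f0.
rewrite measure_bigcup//=; last by move=> n _; exact: mJ.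
apply: nneseries_le => [n|N]; first exact: measure_ge0.
rewrite selS; last by move=> n ->; rewrite measure0.
apply: (@le_trans _ _ (\sum_(p <- map uv (sel N)) (G p.2 - G p.1))%:E).
  rewrite big_map -sumEFin big_seq [leRHS]big_seq; apply: lee_sum => n.
  rewrite mem_filter => /andP[/asboolP /uvP[uvn JE] _].
  rewrite -lebesgue_stieltjes_itv; last exact: ltW.
  apply: le_measure; rewrite ?inE//; rewrite JE//.
  by apply: subset_itvl; rewrite bnd_simp.
rewrite lee_fin; apply: Gd.
- move=> p /mapP[n]; rewrite mem_filter => /andP[/asboolP /uvP[uvn _] _] ->.
  exact: ltW.
- have usel : uniq (sel N) by rewrite filter_uniq ?iota_uniq.
  rewrite pairwise_map.
  have : all (fun n => `[< J n !=set0 >]) (sel N) by exact: filter_all.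
  move: (sel N) usel => s.
  elim: s => //= n s ih /andP[ns us] /andP[/asboolP Jn Js].
  rewrite ih// andbT; apply/allP => k ks /=.
  move/allP : (Js) => /(_ _ ks) /asboolP Jk.
  have nk : n != k by apply: contraNneq ns => ->.
  have [uvn JnE] := uvP _ Jn; have [uvk JkE] := uvP _ Jk.
  rewrite /nonoverlapping leNgt [X in _ || X]leNgt -negb_and; apply/negP => /andP[h1 h2].
  have /trivIsetP/(_ n k Logic.I Logic.I nk) := tJ.
  apply/eqP/set0P.
  exists ((Num.max (uv n).1 (uv k).1 + Num.min (uv n).2 (uv k).2) / 2).
  have h : Num.max (uv n).1 (uv k).1 < Num.min (uv n).2 (uv k).2.
    by rewrite gt_max !lt_min uvn h1 h2 uvk.
  have [m1 m2] := midf_lt h.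
  move: m1 m2; rewrite gt_max lt_min => /andP[? ?] /andP[? ?].
  by split; rewrite ?JnE ?JkE /= in_itv/=; apply/andP; split.
- rewrite -lte_fin; apply: le_lt_trans mUd.
  rewrite big_map -sumEFin.
  apply: (@le_trans _ _ (\sum_(n <- sel N) mu (J n))%E).
    rewrite big_seq [leRHS]big_seq; apply: lee_sum => n.
    rewrite mem_filter => /andP[/asboolP /uvP[uvn JE] _].
    by rewrite JE lebesgue_measure_itv/= lte_fin uvn.
  rewrite -selS; last by move=> n ->; rewrite measure0.
  rewrite [in leRHS]UJ measure_bigcup//=; last by move=> n _; exact: mJ.
  exact: nneseries_lim_ge.
Qed.

(** Small increments say that the Lebesgue-Stieltjes measure of an open set of small
    Lebesgue measure is small.  By outer regularity, Lebesgue-null sets are null for it,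
    and the Radon-Nikodym theorem applies on the bounded interval. *)
Lemma cumulative_density (G : cumulative R R) : small_increments G ->
  forall a b : R, a <= b -> exists rho : R -> R,
    mu.-integrable setT (EFin \o rho) /\
    forall x, a <= x <= b -> G x - G a = \int[mu]_(t in `]a, x]) rho t.
Proof.
move=> Gs a b ab.
pose nu := lebesgue_stieltjes_measure G.
have mab : measurable (`]a, b]%classic : set (measurableTypeR R)) by exact: measurable_itv.
have nuab : (nu `]a, b]%classic < +oo)%E by rewrite /nu lebesgue_stieltjes_itv// ltry.
(* The restriction to ]a, b] is a finite measure, as the Radon-Nikodym theorem requires. *)
pose nu1 : {finite_measure set _ -> \bar R} := mfrestr mab nuab.
have dom : nu1 `<< mu.
  apply/null_content_dominatesP => A mA muA0.
  rewrite /nu1/= /mfrestr/= /mrestr/=.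
  set B := A `&` _.
  have mB : measurable B by exact: measurableI.
  have muB0 : mu B = 0%E.
    by apply/eqP; rewrite eq_le measure_ge0 andbT -muA0 le_measure ?inE//; exact: subIsetl.
  apply/eqP; rewrite eq_le measure_ge0 andbT; apply/lee_addgt0Pr => e e0.
  rewrite add0e.
  have [d d0 Gd] := Gs _ e0.
  have muBoo : (mu B < +oo)%E by rewrite muB0.
  have [U [oU BU muU]] := @lebesgue_regularity_outer R B d mB muBoo d0.
  have mU : measurable U by exact: open_measurable.
  (* A bounded open neighbourhood of ]a, b] avoids a separate treatment of the endpoint b. *)
  apply: (@le_trans _ _ (nu (U `&` `]a - 1, b + 1[%classic))).
    apply: le_measure; rewrite ?inE//; first exact: measurableI.
    move=> x [Ax xab]; split; first exact: BU.
    by move: xab; rewrite /= !in_itv/= => /andP[]; lra.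
  apply: (@cumulative_open_le G e d (a - 1) (b + 1)) => //.
  - by apply: openI => //; exact: interval_open.
  - apply: (@le_lt_trans _ _ (mu U)).
      by apply: le_measure; rewrite ?inE//; exact: measurableI.
    rewrite (_ : mu U = mu (U `\` B))//.
    rewrite -[in LHS](setDUK BU) measureU//; last 2 first.
    + exact: measurableD.
    + by rewrite setDIK.
    by rewrite [X in (X + _)%E](muB0 : mu B = 0%E) add0e.
have [f [f0 ffin intf nuE]] := radon_nikodym_sigma_finite dom.
exists (fine \o f); split.
  rewrite (_ : _ \o _ = f)//; apply/funext => x /=; by rewrite fineK.
move=> x /andP[ax xb].
rewrite /Rintegral.
rewrite (eq_integral f); last by move=> y _ /=; rewrite fineK.
rewrite -nuE//= /nu1 /mfrestr/= /mrestr/= setIidl; last by apply: subset_itvl; rewrite bnd_simp.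
by rewrite lebesgue_stieltjes_itv.
Qed.

End cumulative_density.

(** * Families of intervals and total variation *)

Section absolute_continuity.
Context {R : realType}.
Notation mu := (@lebesgue_measure R).
Implicit Types (a b : R) (h : R -> R) (l : seq (R * R)).

Definition interval_family a b l :=
  (forall p, p \in l -> [/\ a <= p.1, p.1 <= p.2 & p.2 <= b]) /\
  pairwise nonoverlapping l.

Lemma nonoverlappingC (p q : R * R) : nonoverlapping p q = nonoverlapping q p.
Proof. by rewrite /nonoverlapping orbC. Qed.

Lemma abs_continuous_family a b h : abs_continuous a b h ->
  forall e, 0 < e -> exists2 d : R, 0 < d & forall l, interval_family a b l ->
    \sum_(p <- l) (p.2 - p.1) < d -> \sum_(p <- l) `|h p.2 - h p.1| < e.
Proof.
move=> ach e e0; have [d d0 hd] := ach _ e0; exists d => // l [lab lno] ld.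
pose u (i : 'I_(size l)) := (nth (0, 0) l i).1.
pose v (i : 'I_(size l)) := (nth (0, 0) l i).2.
rewrite (big_nth (0, 0)) big_mkord; apply: (hd _ u v).
- by move=> i; apply: lab; exact: mem_nth.
- apply/trivIsetP => i j _ _ ij.
  have {ij}: nonoverlapping (nth (0, 0) l i) (nth (0, 0) l j).
    have := ij; rewrite -val_eqE/= neq_ltn => /orP[] ij'.
      by move/(pairwiseP (0, 0)) : lno; apply; rewrite ?inE.
    by rewrite nonoverlappingC; move/(pairwiseP (0, 0)) : lno; apply; rewrite ?inE.
  move=> no; rewrite -subset0 => x [].
  rewrite /= !in_itv/= => /andP[h1 h2] /andP[h3 h4].
  move: no; rewrite /nonoverlapping => /orP[h5|h5].
    by have := lt_trans (le_lt_trans h5 h3) h2; rewrite ltxx.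
  by have := lt_trans (le_lt_trans h5 h1) h4; rewrite ltxx.
- by move: ld; rewrite (big_nth (0, 0)) big_mkord.
Qed.

Fixpoint consecutive (u : R) (s : seq R) : seq (R * R) :=
  if s is x :: s' then (u, x) :: consecutive x s' else [::].

(** Subdividing an interval keeps the total length and turns the increment of [h] into
    the corresponding variation. *)
Lemma consecutiveP (u v : R) (s : seq R) h : itv_partition u v s ->
  [/\ interval_family u v (consecutive u s),
      \sum_(p <- consecutive u s) (p.2 - p.1) = v - u &
      \sum_(p <- consecutive u s) `|h p.2 - h p.1| = variation u v h s].
Proof.
elim: s u => [|x s ih] u uvs.
  by rewrite /= !big_nil variation_nil (itv_partition_nil uvs) subrr.
have xvs := itv_partition_cons uvs.
have ux : u < x by move: uvs => [] /= /andP[].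
have xv : x <= v := itv_partition_le xvs.
have [[xl xno] xs xh] := ih _ xvs.
split; rewrite /= ?big_cons/=.
- split=> [p|/=]; rewrite ?inE.
    move=> /predU1P[->|/xl[? ? ?]]; first by split => //=; exact: ltW.
    by split => //; rewrite (le_trans (ltW ux)).
  rewrite xno andbT; apply/allP => p /xl[xp _ _].
  by rewrite /nonoverlapping/= xp.
- by rewrite xs; ring.
- by rewrite xh !variation_zip//= big_cons/=.
Qed.

Section family_bound.
Context (a b : R) (h : R -> R) (d e : R).
Context (hd : forall l, interval_family a b l ->
  \sum_(p <- l) (p.2 - p.1) < d -> \sum_(p <- l) `|h p.2 - h p.1| <= e).

(** Intervals contained in [p] do not overlap those that [p] does not overlap. *)
Lemma family_cat pre p r s : interval_family a b (pre ++ p :: r) ->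
  interval_family p.1 p.2 s -> interval_family a b ((pre ++ s) ++ r).
Proof.
move=> [lab lno] [sab sno].
have [pa _ pb] : [/\ a <= p.1, p.1 <= p.2 & p.2 <= b].
  by apply: lab; rewrite mem_cat inE eqxx orbT.
split.
  move=> q; rewrite !mem_cat -orbA => /or3P[ql|/sab[q1 q2 q3]|ql].
  - by apply: lab; rewrite mem_cat ql.
  - by split => //; [exact: le_trans q1|exact: le_trans pb].
  - by apply: lab; rewrite mem_cat inE ql !orbT.
move: lno; rewrite pairwise_cat/= allrel_consr -andbA.
move=> /and5P[prep prer preno pr rno].
have sp q q' : q \in s -> nonoverlapping p q' -> nonoverlapping q q'.
  move=> /sab[q1 q2 q3]; rewrite /nonoverlapping => /orP[q4|q4]; apply/orP.
    by left; exact: le_trans q4.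
  by right; exact: le_trans q1.
rewrite -catA !pairwise_cat allrel_catr prer preno sno rno !andbT/=.
apply/andP; split.
  apply/allrelP => q q' qpre q's; rewrite nonoverlappingC; apply: sp q's _.
  by rewrite nonoverlappingC; move/allP : prep; exact.
by apply/allrelP => q q' qs q'r; apply: sp qs _; move/allP : pr; exact.
Qed.

(** A bound on increments over short families improves to the same bound on total
    variations: the intervals are subdivided one at a time, passing to the supremum over
    the subdivisions of one interval while the others are held fixed. *)
Lemma sum_total_variation_le l : interval_family a b l ->
  \sum_(p <- l) (p.2 - p.1) < d ->
  (\sum_(p <- l) total_variation p.1 p.2 h <= e%:E)%E.
Proof.
(* The list [pre] holds the intervals already subdivided. *)
suff : forall r pre, interval_family a b (pre ++ r) ->
    \sum_(p <- pre ++ r) (p.2 - p.1) < d ->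
    ((\sum_(p <- pre) `|h p.2 - h p.1|)%:E +
     \sum_(p <- r) total_variation p.1 p.2 h <= e%:E)%E.
  by move=> /(_ l [::]) H ll ld; have := H ll ld; rewrite big_nil add0e.
elim=> [|p r ih] pre lf ld.
  by rewrite big_nil adde0 lee_fin; apply: hd; move: lf ld; rewrite cats0.
have [pa p12 pb] : [/\ a <= p.1, p.1 <= p.2 & p.2 <= b].
  by apply: lf.1; rewrite mem_cat inE eqxx orbT.
have key s : itv_partition p.1 p.2 s ->
    ((\sum_(p <- pre) `|h p.2 - h p.1| + variation p.1 p.2 h s)%:E +
     \sum_(p <- r) total_variation p.1 p.2 h <= e%:E)%E.
  move=> ps; have [sf slen <-] := consecutiveP h ps.
  rewrite -big_cat/=; apply: ih; first exact: family_cat lf sf.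
  move: ld; rewrite !big_cat/= big_cons slen; apply: le_lt_trans.
  by rewrite addrA.
set S := (\sum_(p <- r) _)%E in key *.
have S0 : (0 <= S)%E.
  rewrite /S big_seq; apply: sume_ge0 => q qr.
  have [_ ? _] : [/\ a <= q.1, q.1 <= q.2 & q.2 <= b].
    by apply: lf.1; rewrite mem_cat inE qr !orbT.
  exact: total_variation_ge0.
have [s ps] : exists s, itv_partition p.1 p.2 s.
  move: p12; rewrite le_eqVlt => /predU1P[->|p12].
    by exists [::]; split => /=.
  by exists [:: p.2]; exact: itv_partition1.
have Sfin : S \is a fin_num.
  rewrite ge0_fin_numE//; apply: (@le_lt_trans _ _ e%:E); last exact: ltry.
  apply: le_trans (key _ ps); rewrite leeDr// lee_fin addr_ge0 ?variation_ge0//.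
  exact: sumr_ge0.
rewrite big_cons -/S addeCA -leeBrDr ?fin_numD ?Sfin//.
apply: ge_ereal_sup => _ /= [_ [s' ps' <-] <-].
rewrite leeBrDr ?fin_numD ?Sfin//.
have := key _ ps'; by rewrite EFinD (addeC _ (variation _ _ _ _)%:E) addeA.
Qed.

End family_bound.

End absolute_continuity.

(** * Absolutely continuous functions are indefinite integrals *)

Section abs_continuous_density.
Context {R : realType}.
Notation mu := (@lebesgue_measure R).
Implicit Types (a b : R) (h : R -> R) (l : seq (R * R)).

(** The variation over an interval shorter than the modulus for [1] is at most [1], and
    finitely many such intervals cover [a, x]. *)
Lemma abs_continuous_bounded_variation a b h :
  abs_continuous a b h -> forall x, a <= x <= b -> bounded_variation a x h.
Proof.
move=> ach.
have [d d0 hd] := abs_continuous_family ach (@ltr01 R).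
have short u v : a <= u -> u <= v -> v <= b -> v - u < d ->
    (total_variation u v h <= 1%:E)%E.
  move=> au uv vb uvd.
  have := @sum_total_variation_le _ a b h d 1 _ [:: (u, v)].
  rewrite !big_seq1 /=; apply => //.
    by move=> l lf ld; exact/ltW/hd.
  by split => // p; rewrite inE => /eqP ->.
(* Steps of length d / 2 stay below the strict bound d on the length. *)
have H (k : nat) x : a <= x <= b -> x - a <= k%:R * (d / 2) ->
    (total_variation a x h < +oo)%E.
  elim: k x => [|k ih] x /andP[ax xb].
    rewrite mul0r subr_le0 => xa; rewrite (@le_anti _ _ x a) ?xa//.
    by rewrite total_variationxx ltry.
  move=> xk; have [xd|xd] := ltP (x - a) d.
    by apply: le_lt_trans (short _ _ _ ax xb xd) _ => //; exact: ltry.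
  have ay : a <= x - d / 2 by lra.
  have yx : x - d / 2 <= x by lra.
  rewrite (total_variationD h ay yx) lte_add_pinfty//.
    apply: ih; first by apply/andP; split => //; lra.
    by move: xk; rewrite -natr1 mulrDl mul1r; lra.
  by apply: le_lt_trans (short _ _ ay yx xb _) (ltry _); lra.
move=> x /andP[ax xb]; apply/bounded_variationP => //.
rewrite ge0_fin_numE ?total_variation_ge0//.
apply: (H (Num.bound ((x - a) / (d / 2)))); first by rewrite ax.
rewrite -ler_pdivrMr ?divr_gt0//; apply/ltW/archi_boundP.
by rewrite divr_ge0 ?subr_ge0// ltW// divr_gt0.
Qed.

(** Small increments imply continuity, so that [G] is a cumulative function. *)
Lemma nondecreasing_density (G : R -> R) : nondecreasing G ->
  small_increments G -> forall a b : R, a <= b -> exists rho : R -> R,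
    mu.-integrable setT (EFin \o rho) /\
    forall x, a <= x <= b -> G x - G a = \int[mu]_(t in `]a, x]) rho t.
Proof.
move=> ndG sG a b ab.
have rcG : right_continuous G.
  apply: right_continuousW => x; apply/cvgrPdist_le => e e0.
  have [d d0 dG] := sG _ e0.
  have H u v : u <= v -> v - u < d -> G v - G u <= e.
    move=> uv uvd; have := dG [:: (u, v)]; rewrite !big_seq1 /=; apply => //.
    by move=> p; rewrite inE => /eqP ->.
  near=> y.
  have yx : `|x - y| < d by near: y; exact: cvgr_dist_lt.
  have [xy|xy] := leP x y.
    rewrite distrC ger0_norm ?subr_ge0 ?ndG//; apply: H => //.
    by move: yx; rewrite distrC ger0_norm// subr_ge0.
  have xy' := ltW xy.
  by rewrite ger0_norm ?subr_ge0 ?ndG//; apply: H => //; move: yx; rewrite ger0_norm// subr_ge0.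
pose Gc : cumulative R R := HB.pack G (isCumulative.Build _ _ _ G ndG rcG).
exact: (@cumulative_density R Gc).
Unshelve. all: by end_near. Qed.

(** Freezes a function outside [a, b] when composed on the right; this extends the
    variation function of [h] to a monotone function on the whole line. *)
Definition clamp a b (x : R) := Num.min b (Num.max a x).

Lemma clampP a b x : a <= b -> a <= clamp a b x <= b.
Proof. by move=> ab; rewrite /clamp le_min ab le_max lexx/= ge_min lexx. Qed.

Lemma clamp_id a b x : a <= x <= b -> clamp a b x = x.
Proof. by move=> /andP[ax xb]; rewrite /clamp (max_idPr ax) (min_idPr xb). Qed.

Lemma le_clamp a b x y : x <= y -> clamp a b x <= clamp a b y.
Proof.
move=> xy; rewrite /clamp le_min ge_min lexx/= ge_min; apply/orP; right.
by rewrite ge_max le_max lexx/= le_max xy orbT.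
Qed.

Lemma clampB a b x y : a <= b -> x <= y -> clamp a b y - clamp a b x <= y - x.
Proof.
rewrite /clamp => ab xy; case: (leP a x) => ax; case: (leP a y) => ay.
- by case: (leP b x) => bx; case: (leP b y) => by_; lra.
- lra.
- by case: (leP b a) => bx; case: (leP b y) => by_; lra.
- by case: (leP b a) => bx; lra.
Qed.

(** With V the total variation of [h] from [a], both V and V - h are nondecreasing, and
    both have small increments since |h v - h u| <= V v - V u. *)
Lemma abs_continuous_density a b h : a <= b -> abs_continuous a b h ->
  exists rho : R -> R, mu.-integrable setT (EFin \o rho) /\
    forall x, a <= x <= b -> h x - h a = \int[mu]_(t in `]a, x]) rho t.
Proof.
move=> ab ach.
pose c := clamp a b.
have cP x : a <= c x <= b by exact: clampP.
have BVh := abs_continuous_bounded_variation ach.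
have TVfin u v : u <= v -> total_variation (c u) (c v) h \is a fin_num.
  move=> uv; apply/bounded_variationP; first exact: le_clamp.
  by apply: (@bounded_variationr _ a); [case/andP: (cP u)|exact: le_clamp|exact: BVh].
have TV0 x : total_variation a (c x) h \is a fin_num.
  by apply/bounded_variationP; [case/andP: (cP x)|exact: BVh].
pose V x := fine (total_variation a (c x) h).
have VB u v : u <= v -> V v - V u = fine (total_variation (c u) (c v) h).
  move=> uv; rewrite /V (@total_variationD _ a (c v) (c u)).
  - by rewrite fineD ?TVfin// addrAC subrr add0r.
  - by case/andP: (cP u).
  - exact: le_clamp.
pose W x := V x - h (c x).
have WB u v : u <= v -> W v - W u <= 2 * (V v - V u) /\ 0 <= W v - W u.
  move=> uv; have : `|h (c v) - h (c u)| <= V v - V u.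
    by rewrite VB// -lee_fin fineK ?TVfin//; apply: total_variation_ge; exact: le_clamp.
  by rewrite ler_norml => /andP[h1 h2]; rewrite /W; split; lra.
have ndV : nondecreasing V.
  move=> u v uv; rewrite -subr_ge0 VB// fine_ge0// total_variation_ge0//.
  exact: le_clamp.
have ndW : nondecreasing W by move=> u v uv; rewrite -subr_ge0; apply WB.
have sV : small_increments V.
  move=> e e0; have [d d0 hd] := abs_continuous_family ach e0.
  exists d => // l ll lno ld.
  pose l' := [seq (c p.1, c p.2) | p <- l].
  have := @sum_total_variation_le _ a b h d e _ l'.
  rewrite !big_map/= => H.
  rewrite -lee_fin; apply: le_trans (H _ _ _).
  - rewrite -sumEFin big_seq [leRHS]big_seq; apply: lee_sum => p pl.
    by rewrite VB ?ll// fineK// TVfin// ll.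
  - by move=> s sf sd; exact/ltW/hd.
  - split.
      move=> p /mapP[q ql ->] /=; have := cP q.1; have := cP q.2.
      by move=> /andP[_ ?] /andP[? _]; split => //; exact/le_clamp/ll.
    rewrite pairwise_map; apply: sub_pairwise lno => p q.
    by rewrite /nonoverlapping/= => /orP[] /(le_clamp a b) ->; rewrite ?orbT.
  - apply: le_lt_trans ld; rewrite big_seq [leRHS]big_seq; apply: ler_sum => p pl.
    exact/clampB/ll.
have sW : small_increments W.
  move=> e e0; have e20 : 0 < e / 2 by rewrite divr_gt0.
  have [d d0 hd] := sV _ e20; exists d => // l ll lno ld.
  have := hd _ ll lno ld; rewrite ler_pdivlMr// mulrC mulr_sumr.
  apply: le_trans; rewrite big_seq [leRHS]big_seq; apply: ler_sum => p pl.
  by have [] := WB _ _ (ll _ pl).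
have [f [intf fE]] := nondecreasing_density ndV sV ab.
have [g [intg gE]] := nondecreasing_density ndW sW ab.
exists (f \- g); split.
  rewrite (_ : _ \o _ = (EFin \o f) \- (EFin \o g))%E//.
  exact: integrableB.
move=> x axb; rewrite RintegralB//; last 2 first.
- exact: integrableS intf.
- exact: integrableS intg.
rewrite -fE// -gE// /W /c !clamp_id ?lexx//; lra.
Qed.

Lemma abs_continuous_derive_ae a b h rho : mu.-integrable setT (EFin \o rho) ->
  (forall x, a <= x <= b -> h x - h a = \int[mu]_(t in `]a, x]) rho t) ->
  {ae mu, forall x, a < x < b -> is_derive x 1 h (rho x)}.
Proof.
move=> irho hE.
have lrho : locally_integrable [set: R] rho.
  by apply: open_integrable_locally => //; exact: openT.
have iy y : mu.-integrable [set` Interval (BRight a) (BRight y)] (EFin \o rho).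
  exact: integrableS irho.
have := FTC1 iy lrho; apply: filterS; first exact: (ae_filter_ringOfSetsType mu).
move=> x /= H /andP[ax xb].
have [] := H; first by rewrite lte_fin.
move=> dF F'.
have hF : \forall y \near x, h a + \int[mu]_(t in `]a, y]) rho t = h y.
  near=> y; rewrite -hE; first by rewrite addrC subrK.
  apply/andP; split; near: y.
    exact: lt_le_nbhsr.
  exact: lt_le_nbhsl.
have dF1 : is_derive x (1 : R) (fun y => h a + \int[mu]_(t in `]a, y]) rho t) (rho x).
  rewrite -F' derive1E -[X in is_derive _ _ _ X]add0r.
  by apply: is_deriveD; apply: derivableP.
exact: near_eq_is_derive hF dF1.
Unshelve. all: by end_near. Qed.

End abs_continuous_density.

(** * Local integrability on the half-line *)

Section local_integrability.
Context {R : realType}.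
Notation mu := (@lebesgue_measure R).
Implicit Types (a b x : R) (f g h phi : R -> R).

Lemma integrable_mul_bounded (A : set R) f g (M : R) : measurable A ->
  mu.-integrable A (EFin \o f) -> measurable_fun A g ->
  (forall x, A x -> `|g x| <= M) ->
  mu.-integrable A (EFin \o (fun x => f x * g x)).
Proof.
move=> mA intf mg gM.
have mf : measurable_fun A f by move/integrableP: intf => [/measurable_EFinP].
apply: (@le_integrable _ _ _ mu A _ _ (fun x => M%:E * (EFin \o f) x)%E) => //=.
- exact/measurable_EFinP/measurable_funM.
- move=> x Ax; rewrite lee_fin !normrM mulrC ler_wpM2r//.
  by rewrite (le_trans (gM _ Ax))// ler_norm.
- exact: integrableZl.
Qed.

Lemma integrable_mul_square (A : set R) f g : measurable A ->
  measurable_fun A f -> measurable_fun A g ->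
  mu.-integrable A (EFin \o (fun x => f x ^+ 2)) ->
  mu.-integrable A (EFin \o (fun x => g x ^+ 2)) ->
  mu.-integrable A (EFin \o (fun x => f x * g x)).
Proof.
move=> mA mf mg f2 g2.
apply: (@le_integrable _ _ _ mu A _ _
  ((fun x => (f x ^+ 2)%:E) \+ (fun x => (g x ^+ 2)%:E))%E) => //=.
- exact/measurable_EFinP/measurable_funM.
- move=> x Ax; rewrite lee_fin normrM.
  rewrite [leRHS]ger0_norm ?addr_ge0 ?sqr_ge0// -(real_normK (num_real (f x))).
  rewrite -(real_normK (num_real (g x))).
  have := normr_ge0 (f x); have := normr_ge0 (g x).
  by move: `|f x| `|g x| => u v; nra.
- exact: integrableD.
Qed.

Lemma open_Rplus : open (Rplus : set R).
Proof. exact: interval_open. Qed.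

Lemma measurable_Rplus : measurable (Rplus : set R).
Proof. exact: measurable_itv. Qed.

Lemma segment_sub_Rplus a b : 0 < a -> `[a, b]%classic `<=` (Rplus : set R).
Proof.
move=> a0 x /=; rewrite /Rplus /= !in_itv/= andbT => /andP[ax _].
exact: lt_le_trans ax.
Qed.

(** A nonempty compact set has a least and a greatest element. *)
Lemma compact_sub_segment (K : set R) : K `<=` Rplus -> compact K ->
  exists a b : R, [/\ 0 < a, a <= b & K `<=` `[a, b]].
Proof.
move=> K0 cK; have [->|K_neq0] := eqVneq K set0.
  by exists 1, 1; split => //; exact: sub0set.
have cid : {within K, continuous (idfun : R -> R)}.
  by apply: continuous_subspaceT => x; exact: cvg_id.
move/set0P : K_neq0 => Kn.
have [a aK ale] := compact_EVT_min Kn cK cid.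
have [b bK bge] := compact_EVT_max Kn cK cid.
exists a, b; split.
- by have := K0 a (set_mem aK); rewrite /Rplus /= in_itv/= andbT.
- exact: ale.
- by move=> x Kx; rewrite /= in_itv/= ale ?bge ?inE.
Qed.

Lemma locally_integrable_segmentP f : locally_integrable Rplus f <->
  measurable_fun Rplus f /\
  forall a b, 0 < a -> a <= b -> mu.-integrable `[a, b] (EFin \o f).
Proof.
split=> [[mf _ fK]|[mf fab]].
  split=> // a b a0 ab; have sab := @segment_sub_Rplus a b a0.
  apply/integrableP; split.
    by apply/measurable_EFinP; apply: measurable_funS mf => //; exact: measurable_Rplus.
  by apply: fK => //; exact: segment_compact.
split => //.
move=> K K0 cK; have [a [b [a0 ab Kab]]] := compact_sub_segment K0 cK.
have /integrableP[mfab] := fab _ _ a0 ab.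
apply: le_lt_trans; apply: ge0_subset_integral => //=.
- exact: compact_measurable.
- by apply/measurable_EFinP; apply: measurableT_comp => //; exact/measurable_EFinP.
Qed.

Lemma locally_integrableM_continuous f g : locally_integrable Rplus f ->
  {in Rplus, continuous g} -> locally_integrable Rplus (fun x => f x * g x).
Proof.
move=> /locally_integrable_segmentP[mf fab] cg.
have mg : measurable_fun Rplus g.
  by apply: open_continuous_measurable_fun => //; exact: open_Rplus.
apply/locally_integrable_segmentP; split; first exact: measurable_funM.
move=> a b a0 ab; have sab := @segment_sub_Rplus a b a0.
have cab : {within `[a, b], continuous g}.
  by apply: continuous_in_subspaceT => x /set_mem xab; apply: cg; apply/mem_set/sab.
have [M [_ gM]] : bounded_set (g @` `[a, b]).
  by apply: compact_bounded; apply: continuous_compact => //; exact: segment_compact.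
apply: (@integrable_mul_bounded _ _ _ (M + 1)) => //.
- exact: fab.
- by apply: measurable_funS mg => //; exact: measurable_Rplus.
- by move=> x xab; apply: (gM (M + 1)); [rewrite ltrDl|exists x].
Qed.

Lemma locally_integrableM_square f g :
  measurable_fun Rplus f -> measurable_fun Rplus g ->
  locally_integrable Rplus (fun x => f x ^+ 2) ->
  locally_integrable Rplus (fun x => g x ^+ 2) ->
  locally_integrable Rplus (fun x => f x * g x).
Proof.
move=> mf mg /locally_integrable_segmentP[_ f2] /locally_integrable_segmentP[_ g2].
apply/locally_integrable_segmentP; split; first exact: measurable_funM.
move=> a b a0 ab; have sab := @segment_sub_Rplus a b a0.
apply: integrable_mul_square => //.
- by apply: measurable_funS mf => //; exact: measurable_Rplus.
- by apply: measurable_funS mg => //; exact: measurable_Rplus.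
- exact: f2.
- exact: g2.
Qed.

Lemma continuous_locally_integrable g : {in Rplus, continuous g} ->
  locally_integrable Rplus g.
Proof.
move=> cg; have := @locally_integrableM_continuous (cst 1) g _ cg.
rewrite (_ : (fun x => cst 1 x * g x) = g); last by apply/funext => x; rewrite mul1r.
apply; rewrite -[cst 1]indicT.
exact: (locally_integrable_indic open_Rplus).
Qed.

Definition supported_in a b phi := forall x, ~ (a <= x <= b) -> phi x = 0.

(** For functions supported in [a, b], integrating over the half-line or over [a, b] is
    the same. *)
Lemma supported_restrict a b (F : R -> \bar R) : 0 < a ->
  (forall x, ~ (a <= x <= b) -> F x = 0%E) -> F \_ Rplus = F \_ `[a, b].
Proof.
move=> a0 F0; apply/funext => x; rewrite !patchE.
case: (boolP (x \in `[a, b]%classic)) => xab.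
  by rewrite mem_set//; apply: (@segment_sub_Rplus a b) => //; exact/set_mem.
rewrite F0 ?if_same// => axb; move/negP : xab; apply.
by rewrite inE /= in_itv.
Qed.

Lemma supported_integrable a b f phi : 0 < a -> a <= b ->
  locally_integrable Rplus f -> continuous phi -> supported_in a b phi ->
  mu.-integrable Rplus (EFin \o (fun x => f x * phi x)).
Proof.
move=> a0 ab lf cphi sphi.
have /locally_integrable_segmentP[_ /(_ a b a0 ab) i] :
    locally_integrable Rplus (fun x => f x * phi x).
  by apply: locally_integrableM_continuous => // x _; exact: cphi.
apply/integrable_mkcond; first exact: measurable_Rplus.
rewrite (@supported_restrict a b)//; last by move=> x xab /=; rewrite sphi ?mulr0.
by apply: (integrable_mkcond _ _).1 => //; exact: i.
Qed.

Lemma supported_Rintegral a b F : 0 < a -> supported_in a b F ->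
  \int[mu]_(x in Rplus) F x = \int[mu]_(x in `[a, b]) F x.
Proof.
move=> a0 sF; rewrite /Rintegral [in LHS]integral_mkcond [in RHS]integral_mkcond.
by rewrite (@supported_restrict a b (EFin \o F))// => x /sF /= ->.
Qed.

Lemma ae_eq_Rintegral (D : set R) f g : measurable D ->
  measurable_fun D f -> measurable_fun D g ->
  {ae mu, forall x, D x -> f x = g x} ->
  \int[mu]_(x in D) f x = \int[mu]_(x in D) g x.
Proof.
move=> mD mf mg fg; rewrite /Rintegral; congr fine; apply: ae_eq_integral => //.
- exact/measurable_EFinP.
- exact/measurable_EFinP.
- by apply: filterS fg; first exact: (ae_filter_ringOfSetsType mu); move=> x H /H ->.
Qed.

End local_integrability.

(** * Locally absolutely continuous functions and integration by parts *)

Section local_absolute_continuity.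
Context {R : realType}.
Notation mu := (@lebesgue_measure R).
Implicit Types (a b x : R) (f g h phi : R -> R).

Lemma ae_mono (P Q : R -> Prop) : (forall x, P x -> Q x) ->
  {ae mu, forall x, P x} -> {ae mu, forall x, Q x}.
Proof.
by move=> PQ; apply: filterS => //; exact: (ae_filter_ringOfSetsType mu).
Qed.

Lemma ae_and (P Q : R -> Prop) : {ae mu, forall x, P x} -> {ae mu, forall x, Q x} ->
  {ae mu, forall x, P x /\ Q x}.
Proof.
by move=> h1 h2; apply: filterS2 h1 h2; [exact: (ae_filter_ringOfSetsType mu)|].
Qed.

Lemma ae_integrable (D : set R) f g : measurable D ->
  mu.-integrable D (EFin \o f) -> measurable_fun D g ->
  {ae mu, forall x, D x -> f x = g x} -> mu.-integrable D (EFin \o g).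
Proof.
move=> mD /integrableP[mf fD] mg fg; apply/integrableP; split.
  exact/measurable_EFinP.
rewrite (@ae_eq_integral _ _ _ mu D (fun x => `|(EFin \o f) x|%E))//.
- exact/measurableT_comp/measurable_EFinP.
- exact/measurableT_comp.
- by apply: ae_mono fg => x H /H /= ->.
Qed.

Lemma abs_continuous_dist a b h : abs_continuous a b h ->
  forall e, 0 < e -> exists2 d, 0 < d & forall u v, a <= u <= b -> a <= v <= b ->
    `|u - v| < d -> `|h u - h v| < e.
Proof.
move=> ach e e0; have [d d0 hd] := abs_continuous_family ach e0.
have H u v : a <= u <= b -> a <= v <= b -> u <= v -> v - u < d -> `|h v - h u| < e.
  move=> /andP[au ub] /andP[av vb] uv uvd; have := hd [:: (u, v)].
  rewrite !big_seq1 /=; apply => //.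
  by split => // p; rewrite inE => /eqP ->.
exists d => // u v uab vab; have [uv|vu] := leP u v.
  by rewrite distrC (distrC (h u)) (ger0_norm (_ : 0 <= v - u)) ?subr_ge0//; exact: H.
rewrite (ger0_norm (_ : 0 <= u - v)) ?subr_ge0 ?(ltW vu)//; apply: H => //.
exact: ltW.
Qed.

Lemma abs_continuous_bounded a b h : abs_continuous a b h ->
  exists M, forall x, a <= x <= b -> `|h x| <= M.
Proof.
move=> ach; have [ab|ab] := leP a b; last first.
  exists 0 => x /andP[ax xb]; have := le_trans ax xb; by rewrite leNgt ab.
exists (`|h a| + fine (total_variation a b h)) => x /andP[ax xb].
have bv := abs_continuous_bounded_variation ach.
have : `|h x - h a| <= fine (total_variation a b h).
  rewrite -lee_fin fineK; last first.
    by apply/bounded_variationP => //; apply: bv; rewrite ab lexx.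
  rewrite (total_variationD h ax xb); apply: le_trans (total_variation_ge h ax) _.
  by rewrite leeDl// total_variation_ge0.
move=> H; rewrite -[X in `|X|](subrK (h a)) addrC.
by rewrite (le_trans (ler_normD _ _))// lerD2l.
Qed.

(** Both factors are bounded by some M on [a, b], and an increment of the product is at
    most M times the sum of the increments of the factors. *)
Lemma abs_continuousM a b f g : abs_continuous a b f -> abs_continuous a b g ->
  abs_continuous a b (fun x => f x * g x).
Proof.
move=> acf acg e e0.
have [Mf Hf] := abs_continuous_bounded acf.
have [Mg Hg] := abs_continuous_bounded acg.
pose M := `|Mf| + `|Mg| + 1.
have M0 : 0 < M by rewrite ltr_wpDl// addr_ge0.
have e20 : 0 < e / M / 2 by rewrite !divr_gt0.
have [df df0 hf] := acf _ e20; have [dg dg0 hg] := acg _ e20.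
exists (Num.min df dg); first by rewrite lt_min df0.
move=> N u v uv tuv; rewrite lt_min => /andP[uvf uvg].
have := ltrD (hf N u v uv tuv uvf) (hg N u v uv tuv uvg).
rewrite -splitr ltr_pdivlMr// mulrC; apply: le_lt_trans.
rewrite -big_split/= mulr_sumr; apply: ler_sum => i _.
have [ui uvi vi] := uv i.
have fu : `|f (u i)| <= M.
  rewrite (le_trans (Hf _ _)) ?ui ?(le_trans uvi)//.
  by rewrite /M (le_trans (ler_norm _))// -addrA lerDl addr_ge0.
have gv : `|g (v i)| <= M.
  rewrite (le_trans (Hg _ _)) ?vi ?(le_trans ui)//.
  by rewrite /M (le_trans (ler_norm _))// addrAC lerDr addr_ge0.
rewrite (_ : _ - _ = (f (v i) - f (u i)) * g (v i) + f (u i) * (g (v i) - g (u i))); last by ring.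
rewrite (le_trans (ler_normD _ _))// !normrM mulrDr lerD//.
  by rewrite mulrC ler_wpM2r.
by rewrite ler_wpM2r.
Qed.

(** By the mean value theorem the function is Lipschitz on [a, b]. *)
Lemma C1_abs_continuous a b phi : (forall x, derivable phi x 1) ->
  continuous (derive1 phi) -> abs_continuous a b phi.
Proof.
move=> dphi cphi e e0.
have [M [_ HM]] : bounded_set (derive1 phi @` `[a, b]).
  apply: compact_bounded; apply: continuous_compact; last exact: segment_compact.
  exact: continuous_subspaceT.
have M10 : 0 < `|M| + 1 by rewrite ltr_wpDl.
exists (e / (`|M| + 1)); first by rewrite divr_gt0.
move=> N u v uv _; rewrite ltr_pdivlMr// mulrC mulr_sumr; apply: le_lt_trans.
apply: ler_sum => i _; have [ui uvi vi] := uv i.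
have [] := @MVT_segment _ phi (derive1 phi) (u i) (v i) uvi.
- by move=> x _; rewrite derive1E; exact: derivableP.
- apply: continuous_subspaceT => x; apply: differentiable_continuous.
  exact/derivable1_diffP.
move=> c; rewrite in_itv/= => /andP[uc cv] ->.
rewrite normrM (ger0_norm (_ : 0 <= v i - u i)) ?subr_ge0// ler_wpM2r ?subr_ge0//.
apply: HM; first by rewrite (le_lt_trans (ler_norm M))// ltrDl.
by exists c => //=; rewrite in_itv/= (le_trans ui uc) (le_trans cv vi).
Qed.

Definition locally_abs_continuous h :=
  forall a b, 0 < a -> a <= b -> abs_continuous a b h.

Lemma locally_abs_continuous_continuous h : locally_abs_continuous h ->
  {in Rplus, continuous h}.
Proof.
move=> lh x; rewrite inE /Rplus /= in_itv/= andbT => x0.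
apply/cvgrPdist_lt => e e0.
have ab : x / 2 <= x + 1 by lra.
have a0 : 0 < x / 2 by rewrite divr_gt0.
have [d d0 hd] := abs_continuous_dist (lh _ _ a0 ab) e0.
near=> y; apply: hd; first by apply/andP; split; lra.
- apply/andP; split; near: y.
    by apply: lt_le_nbhsr; lra.
  by apply: lt_le_nbhsl; lra.
- by near: y; exact: cvgr_dist_lt.
Unshelve. all: by end_near. Qed.

(** The half-line is the countable union of the intervals ]1/N, N[. *)
Lemma ae_Rplus (P : R -> Prop) :
  (forall a b, 0 < a -> a <= b -> {ae mu, forall x, a < x < b -> P x}) ->
  {ae mu, forall x, 0 < x -> P x}.
Proof.
move=> Pab.
have H n : {ae mu, forall x, n.+2%:R^-1 < x < n.+2%:R -> P x}.
  by apply: Pab; rewrite ?invr_gt0// (@le_trans _ _ 1) ?invf_le1 ?ler1n.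
move/ae_foralln : H; apply: ae_mono.
move=> x /(_ (Num.bound (x + x^-1))); set N := Num.bound _ => H x0; apply: H.
have : x + x^-1 < N%:R.
  by apply: archi_boundP; rewrite addr_ge0 ?invr_ge0 ?ltW.
have xi : 0 < x^-1 by rewrite invr_gt0.
have : N%:R <= N.+2%:R :> R by rewrite ler_nat -addn2 leq_addr.
move=> h1 h2; apply/andP; split; last by lra.
by rewrite invf_plt ?posrE//; lra.
Qed.

(** The a.e. derivative is obtained on each [a, b] separately; the upper limit of
    difference quotients glues these functions into one that is measurable on the whole
    half-line. *)
Lemma locally_abs_continuous_density h : locally_abs_continuous h ->
  exists rho, locally_integrable Rplus rho /\
    {ae mu, forall x, 0 < x -> is_derive x 1 h (rho x)}.
Proof.
move=> lh; have ch := locally_abs_continuous_continuous lh.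
have loc a b : 0 < a -> a <= b -> exists rho : R -> R,
    mu.-integrable setT (EFin \o rho) /\
    {ae mu, forall x, a < x < b -> is_derive x 1 h (rho x)}.
  move=> a0 ab; have [rho [irho hrho]] := abs_continuous_density ab (lh _ _ a0 ab).
  by exists rho; split => //; exact: abs_continuous_derive_ae hrho.
pose D (n : nat) x := n.+1%:R * (h (x + n.+1%:R^-1) - h x).
(* Wherever [h] is differentiable this is the derivative; measurability holds everywhere. *)
pose rho x := fine (limn_esup (fun n => (D n x)%:E)).
have rhoE x l : is_derive x 1 h l -> rho x = l.
  move=> dh; suff H : (fun n => (D n x)%:E) @ \oo --> l%:E.
    by rewrite /rho is_cvg_limn_esupE ?(cvg_lim _ H)//; apply/cvg_ex; exists l%:E.
  apply/cvg_EFin; first exact: nearW.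
  have [dv <-] := dh.
  move/cvgr_dnbhsP : dv => /(_ (fun n => n.+1%:R^-1)) H.
  have {}H := H (conj _ (@cvg_harmonic R)).
  apply: cvg_trans (H _); last by move=> n; rewrite invr_neq0.
  apply: near_eq_cvg; apply: nearW => n.
  by rewrite /D /= invrK [_ *: 1]mulr1 (addrC _ x).
have ae_rho : {ae mu, forall x, 0 < x -> is_derive x 1 h (rho x)}.
  apply: ae_Rplus => a b a0 ab; have [r [ir]] := loc _ _ a0 ab.
  by apply: ae_mono => x /[apply] dr; rewrite (rhoE _ _ dr).
have mrho : measurable_fun Rplus rho.
  apply: measurableT_comp; first exact: fine_measurable.
  apply: measurable_fun_limn_esup => n; apply/measurable_EFinP.
  apply: open_continuous_measurable_fun; first exact: open_Rplus.
  move=> x xR; apply: cvgM; first exact: cvg_cst.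
  apply: cvgB; last exact: ch.
  apply: (@cvg_comp _ _ _ (fun y => y + n.+1%:R^-1) h _ (nbhs (x + n.+1%:R^-1))).
    by apply: cvgD; [exact: cvg_id|exact: cvg_cst].
  apply: ch; move: xR; rewrite !inE /Rplus /= !in_itv/= !andbT => x0.
  by rewrite addr_gt0// invr_gt0.
exists rho; split=> //.
apply/locally_integrable_segmentP; split => // a b a0 ab.
have a20 : 0 < a / 2 by rewrite divr_gt0.
have ab' : a / 2 <= b + 1 by lra.
have [r [ir hr]] := loc _ _ a20 ab'.
have sab := @segment_sub_Rplus _ a b a0.
have irab : mu.-integrable `[a, b] (EFin \o r) by exact: integrableS ir.
apply: (@ae_integrable `[a, b]%classic r) => //.
- apply: measurable_funS mrho => //.
  exact: measurable_Rplus.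
- apply: ae_mono hr.
  move=> x H; rewrite /= in_itv/= => /andP[ax xb].
  by apply/esym/rhoE/H; apply/andP; split; lra.
Qed.

(** Outside the closed interval the function vanishes in a neighbourhood. *)
Lemma supported_derive a b phi : supported_in a b phi ->
  supported_in a b (derive1 phi).
Proof.
move=> sphi x xab; rewrite derive1E -(derive_cst (0 : R) (1 : R) x).
apply: near_eq_derive.
have : x < a \/ b < x.
  have [xa|ax] := ltP x a; first by left.
  right; rewrite ltNge; apply/negP => xb; by apply: xab; rewrite ax.
case=> xc; near=> y; apply: sphi => /andP[ay yb].
  have : y < a by near: y; exact: lt_nbhsl.
  by rewrite ltNge ay.
have : b < y by near: y; exact: lt_nbhsr.
by rewrite ltNge yb.
Unshelve. all: by end_near. Qed.

(** The product of [h] and [phi] is absolutely continuous and vanishes at both ends of an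
    interval slightly larger than [a, b], so the integral of its derivative is 0. *)
Lemma integration_by_parts_test h rho phi a b : locally_abs_continuous h ->
  locally_integrable Rplus rho ->
  {ae mu, forall x, 0 < x -> is_derive x 1 h (rho x)} ->
  0 < a -> a <= b -> (forall x, derivable phi x 1) ->
  continuous (derive1 phi) -> supported_in a b phi ->
  \int[mu]_(x in Rplus) (h x * derive1 phi x) =
  - \int[mu]_(x in Rplus) (rho x * phi x).
Proof.
move=> lh lrho hrho a0 ab dphi cdphi sphi.
have cphi : continuous phi.
  by move=> x; apply: differentiable_continuous; exact/derivable1_diffP.
have lih := continuous_locally_integrable (locally_abs_continuous_continuous lh).
have sdphi := supported_derive sphi.
have i1 := supported_integrable a0 ab lih cdphi sdphi.
have i2 := supported_integrable a0 ab lrho cphi sphi.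
apply/eqP; rewrite -addr_eq0 -RintegralD//; last exact: measurable_Rplus.
have a20 : 0 < a / 2 by rewrite divr_gt0.
have ab' : a / 2 <= b + 1 by lra.
rewrite (@supported_Rintegral _ (a / 2) (b + 1))//; last first.
  move=> x xab; rewrite sdphi ?sphi ?mulr0 ?addr0//.
    by apply: contra_not xab => /andP[? ?]; apply/andP; split; lra.
  by apply: contra_not xab => /andP[? ?]; apply/andP; split; lra.
have ac : abs_continuous (a / 2) (b + 1) (fun x => h x * phi x).
  by apply: abs_continuousM; [exact: lh|exact: C1_abs_continuous].
have [r [ir hr]] := abs_continuous_density ab' ac.
have dr := abs_continuous_derive_ae ir hr.
have := hr (b + 1); rewrite !sphi ?mulr0 ?subrr; last 2 first.
- by move=> /andP[? ?]; lra.
- by move=> /andP[? ?]; lra.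
rewrite ab' lexx => /(_ isT) ->.
have irab : mu.-integrable `]a / 2, b + 1] (EFin \o r) by exact: integrableS ir.
have i12 : mu.-integrable `[a / 2, b + 1] (EFin \o (fun x => h x * derive1 phi x + rho x * phi x)).
  apply: (@integrableS _ _ _ mu Rplus) => //; first exact: measurable_Rplus.
    exact: segment_sub_Rplus.
  rewrite (_ : _ \o _ = ((fun x => (h x * derive1 phi x)%:E) \+
    (fun x => (rho x * phi x)%:E))%E)//.
  by apply: integrableD => //; exact: measurable_Rplus.
rewrite Rintegral_itv_obnd_cbnd//; apply/eqP; apply: ae_eq_Rintegral => //.
- by move/integrableP : i12 => [/measurable_EFinP].
- by move/integrableP : ir => [/measurable_EFinP mr _]; exact: measurable_funTS.
have nb : {ae mu, forall x, x != a / 2 /\ x != b + 1}.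
  exists [set a / 2; b + 1]; split => //.
  - by apply: measurableU; exact: measurable_set1.
  - by apply: countable_lebesgue_measure0; exact: finite_set_countable.
  - move=> x /= /not_andP[] /negP; rewrite negbK => /eqP ->; [by left|by right].
apply: ae_mono (ae_and nb (ae_and hrho dr)) => x [[xa xb] [dh dhp]].
rewrite /= in_itv/= => /andP[ax bx].
have x0 : 0 < x by lra.
have {}dhp : is_derive x 1 (fun x => h x * phi x) (r x).
  by apply: dhp; rewrite !lt_neqAle ax bx xb eq_sym xa.
have {}dh := dh x0.
have dp : is_derive x 1 phi (derive1 phi x) by rewrite derive1E; exact: derivableP.
have [_ <-] := dhp; have [_ ->] := is_deriveM dh dp.
by rewrite /GRing.scale/= [phi x * _]mulrC.
Qed.

End local_absolute_continuity.

(** * Smooth functions and smooth approximations of the indicator of an interval *)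

Section smooth_functions.
Context {R : realType}.
Notation mu := (@lebesgue_measure R).
Implicit Types (a b c d x : R) (f g h phi : R -> R) (k n : nat).

Definition smooth f := forall k x, derivable (derive1n k f) x 1.

(** An inductive form of k-fold differentiability that follows the derivative of the
    whole function, so that closure under sums, products and compositions is proved by
    induction on [k]. *)
Fixpoint diffn k f : Prop :=
  if k is k'.+1 then (forall x, derivable f x 1) /\ diffn k' (derive1 f) else True.

Lemma derive1nSr k f : derive1n k.+1 f = derive1n k (derive1 f).
Proof. by rewrite /derive1n iterSr. Qed.

Lemma diffn_smooth f : (forall k, diffn k f) -> smooth f.
Proof.
move=> df k; elim: k f df => [|k ih] f df x; first by have [] := df 1%N.
by rewrite derive1nSr; apply: ih => j; have [] := df j.+1.
Qed.

Lemma smooth_derive f : smooth f -> smooth (derive1 f).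
Proof. by move=> sf k x; rewrite -derive1nSr; exact: sf. Qed.

Lemma smooth_derive1n k f : smooth f -> smooth (derive1n k f).
Proof.
by elim: k f => // k ih f sf; rewrite derive1nSr; exact/ih/smooth_derive.
Qed.

Lemma derivable_continuous f : (forall x, derivable f x 1) -> continuous f.
Proof.
by move=> df x; apply: differentiable_continuous; exact/derivable1_diffP.
Qed.

Lemma smooth_continuous f : smooth f -> continuous f.
Proof. by move=> sf; apply: derivable_continuous; exact: (sf 0%N). Qed.

Lemma diffnS k f g : (forall x, is_derive x 1 f (g x)) -> diffn k g ->
  diffn k.+1 f.
Proof.
move=> fg dg; split; first by move=> x; have [] := fg x.
rewrite (_ : derive1 f = g)//; apply/funext => x; rewrite derive1E.
by have [_ ->] := fg x.
Qed.

Lemma diffnW k f : diffn k.+1 f -> diffn k f.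
Proof.
elim: k f => // k ih f [df dk]; split => //; exact: ih.
Qed.

Lemma diffn_is_derive k f x : diffn k.+1 f -> is_derive x 1 f (derive1 f x).
Proof. by move=> [df _]; rewrite derive1E; exact: derivableP. Qed.

Lemma diffn_cst k c : diffn k (cst c).
Proof.
elim: k c => // k ih c; apply: (@diffnS _ _ (cst 0)) => //.
Qed.

Lemma diffnD k f g : diffn k f -> diffn k g -> diffn k (fun x => f x + g x).
Proof.
elim: k f g => // k ih f g df dg.
apply: (@diffnS _ _ (fun x => derive1 f x + derive1 g x)).
  by move=> x; apply: is_deriveD; [exact: diffn_is_derive df|exact: diffn_is_derive dg].
by apply: ih; [case: df|case: dg].
Qed.

Lemma diffnM k f g : diffn k f -> diffn k g -> diffn k (fun x => f x * g x).
Proof.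
elim: k f g => // k ih f g df dg.
apply: (@diffnS _ _ (fun x => f x * derive1 g x + g x * derive1 f x)).
  by move=> x; apply: is_deriveM; [exact: diffn_is_derive df|exact: diffn_is_derive dg].
by apply: diffnD; apply: ih; [exact: diffnW|case: dg|exact: diffnW|case: df].
Qed.

Lemma diffn_affine k f s t : diffn k f -> diffn k (fun x => f (s * x + t)).
Proof.
elim: k f => // k ih f df.
apply: (@diffnS _ _ (fun x => derive1 f (s * x + t) * s)).
  move=> x; apply: (@is_derive1_comp _ f (fun x => s * x + t)).
    exact: diffn_is_derive df.
  have h1 := @is_deriveM _ _ (cst s) id x 1 _ _ (is_derive_cst s x 1) (is_derive_id x 1).
  apply: is_derive_eq (is_deriveD h1 (is_derive_cst t x 1)) _.
  by rewrite addr0 scaler0 addr0 [_ *: _]mulr1.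
by apply: diffnM; [apply: ih; case: df|exact: diffn_cst].
Qed.

Lemma diffn_exp k f : diffn k f -> diffn k (fun x => expR (f x)).
Proof.
elim: k f => // k ih f df.
apply: (@diffnS _ _ (fun x => expR (f x) * derive1 f x)).
  by move=> x; apply: (@is_derive1_comp _ expR f); exact: diffn_is_derive df.
by apply: diffnM; [exact/ih/diffnW|case: df].
Qed.

(** The functions x^-n exp (-1/x), continued by 0: a family that contains the standard
    flat function and is stable under differentiation up to linear combinations. *)
Definition flat_exp n x : R := if 0 < x then x^-1 ^+ n * expR (- x^-1) else 0.

(** From exp t >= (t / k)^k with t = 1/x and k = n + 1. *)
Lemma flat_exp_le n : exists2 C : R, 0 < C & forall x, `|flat_exp n x| <= C * `|x|.
Proof.
have n0 : 0 < n.+1%:R :> R by [].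
exists (n.+1%:R ^+ n.+1); first by rewrite exprn_gt0.
move=> x; rewrite /flat_exp; case: ifPn => x0; last by rewrite normr0 mulr_ge0 ?exprn_ge0.
have xi : 0 < x^-1 by rewrite invr_gt0.
rewrite ger0_norm ?mulr_ge0 ?exprn_ge0 ?expR_ge0 ?(ltW xi)// gtr0_norm//.
rewrite expRN ler_pdivrMr ?expR_gt0//.
rewrite -(ler_pM2l xi) -exprS.
have -> (C E : R) : x^-1 * (C * x * E) = C * E by field; rewrite gt_eqF.
have -> : expR x^-1 = expR (x^-1 / n.+1%:R) ^+ n.+1.
  by rewrite -expRM_natr mulfVK// gt_eqF.
rewrite -exprMn ler_pXn2r ?nnegrE ?mulr_ge0 ?expR_ge0 ?(ltW xi)//.
rewrite -ler_pdivrMl// [_^-1 * _]mulrC; apply: le_trans (expR_ge1Dx _).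
by rewrite lerDr.
Qed.

(** At 0 the difference quotient of the n-th function is the value of the next one,
    which tends to 0. *)
Lemma flat_exp_is_derive n x : is_derive x 1 (flat_exp n)
  (flat_exp n.+2 x - n%:R * flat_exp n.+1 x).
Proof.
have [x0|x0|->] := ltgtP x 0.
- have -> : flat_exp n.+2 x - n%:R * flat_exp n.+1 x = 0.
    by rewrite /flat_exp ltNge (ltW x0)/= mulr0 subr0.
  apply: (@near_eq_is_derive _ _ _ (cst 0)).
  near=> y; rewrite /flat_exp ifN// -leNgt; near: y; exact: lt_le_nbhsl.
- have fE : \near x, x^-1 ^+ n * expR (- x^-1) = flat_exp n x.
    by near=> y; rewrite /flat_exp ifT//; near: y; exact: lt_nbhsr.
  apply: near_eq_is_derive fE _.
  have xn : x != 0 by rewrite gt_eqF.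
  have dv : is_derive x (1 : R) (fun y => y^-1) (- x ^- 2).
    have := @is_deriveV _ (fun y : R => y) x 1 1 xn (is_derive_id _ _).
    by rewrite [_ *: _]mulr1.
  have dn := @is_deriveX _ _ _ n x 1 _ dv.
  rewrite exprfctE /= in dn.
  have de := @is_derive1_comp _ expR (fun y => - y^-1) x _ _ (is_derive_expR _) (is_deriveN dv).
  apply: is_derive_eq (is_deriveM dn de) _.
  rewrite /flat_exp x0 /GRing.scale/= -!exprVn; move: (expR (- x^-1)) (x^-1) => e v.
  by case: (n) => [|m]; rewrite /= ?exprS; ring.
- have E : flat_exp n.+2 0 - n%:R * flat_exp n.+1 0 = 0 by rewrite /flat_exp ltxx mulr0 subr0.
  rewrite E.
  have H : (fun h : R => h^-1 *: (flat_exp n (h *: 1 + 0) - flat_exp n 0)) @ 0^' --> (0 : R).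
    have [C C0 hC] := flat_exp_le n.+1.
    apply/cvgrPdist_lt => e e0; near=> h.
    have -> : h^-1 *: (flat_exp n (h *: 1 + 0) - flat_exp n 0) = flat_exp n.+1 h.
      rewrite /flat_exp ltxx subr0 addr0 [h *: 1]mulr1; case: ifPn => _.
        by rewrite [_ *: _]mulrA -exprS.
      by rewrite scaler0.
    rewrite sub0r normrN (le_lt_trans (hC h))// mulrC -ltr_pdivlMr//.
    near: h; apply: dnbhs0_lt; exact: divr_gt0.
  apply: DeriveDef; first exact: cvgP H.
  exact: cvg_lim H.
Unshelve. all: by end_near. Qed.

Lemma diffn_flat_exp k n : diffn k (flat_exp n).
Proof.
elim: k n => // k ih n; apply: diffnS; first exact: flat_exp_is_derive.
apply: diffnD; first exact: ih.
rewrite (_ : (fun x => _) = (fun x => (- n%:R) * flat_exp n.+1 x)).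
  by apply: diffnM; [exact: diffn_cst|exact: ih].
by apply/funext => x; rewrite mulNr.
Qed.

(** With beta the product of the two flat factors, which is positive exactly on ]c, d[,
    1 - exp (- n beta) tends to 1 on ]c, d[ and is 0 elsewhere. *)
Definition plateau c d n x : R :=
  1 - expR (- (n%:R * (flat_exp 0 (x - c) * flat_exp 0 (d - x)))).

Lemma plateau_smooth c d n : smooth (plateau c d n).
Proof.
apply: diffn_smooth => k; apply: diffnD; first exact: diffn_cst.
rewrite (_ : (fun x => - _) = (fun x => -1 * expR (- n%:R *
    (flat_exp 0 (1 * x + - c) * flat_exp 0 (-1 * x + d))))).
  apply: diffnM; first exact: diffn_cst.
  apply: diffn_exp; apply: diffnM; first exact: diffn_cst.
  by apply: diffnM; apply: diffn_affine; exact: diffn_flat_exp.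
by apply/funext => x; rewrite mulN1r mulNr mul1r mulN1r (addrC (- x)).
Qed.

Lemma flat_exp_ge0 n x : 0 <= flat_exp n x.
Proof.
by rewrite /flat_exp; case: ifPn => // x0; rewrite mulr_ge0 ?expR_ge0 ?exprn_ge0 ?invr_ge0 ?ltW.
Qed.

Lemma plateau_supported c d n : supported_in c d (plateau c d n).
Proof.
move=> x xcd; rewrite /plateau (_ : flat_exp 0 _ * _ = 0) ?mulr0 ?oppr0 ?expR0 ?subrr//.
apply/eqP; rewrite mulf_eq0 /flat_exp !subr_gt0.
case: ifPn => cx; last by rewrite eqxx.
case: ifPn => xd; last by rewrite eqxx orbT.
by exfalso; apply: xcd; rewrite !ltW.
Qed.

Lemma plateau_bound c d n x : 0 <= plateau c d n x <= 1.
Proof.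
rewrite /plateau subr_ge0 gerBl expR_ge0 andbT -expR0 ler_expR oppr_le0.
by rewrite !mulr_ge0// flat_exp_ge0.
Qed.

Lemma plateau_cvg c d x : c < x < d -> (plateau c d n x) @[n --> \oo] --> (1 : R).
Proof.
move=> /andP[cx xd]; rewrite -[X in _ --> X]subr0.
apply: cvgB; first exact: cvg_cst.
set b := flat_exp 0 (x - c) * flat_exp 0 (d - x).
have b0 : 0 < b.
  by rewrite /b /flat_exp !subr_gt0 cx xd mulr_gt0// mulr_gt0// expR_gt0.
under eq_fun do rewrite -mulrN expRM_natl.
apply: cvg_expr; rewrite ger0_norm ?expR_ge0// -expR0 ltr_expR oppr_lt0//.
Qed.

End smooth_functions.

(** * The fundamental lemma of the calculus of variations *)

Section fundamental_lemma.
Context {R : realType}.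
Notation mu := (@lebesgue_measure R).
Implicit Types (a b c d x : R) (f g h phi : R -> R) (k n : nat).

(** The plateau functions are bounded by 1 and tend to the indicator of ]c, d[;
    dominated convergence applies. *)
Lemma plateau_Rintegral0 f : locally_integrable Rplus f ->
  (forall phi a b, smooth phi -> 0 < a -> a <= b -> supported_in a b phi ->
    \int[mu]_(x in Rplus) (f x * phi x) = 0) ->
  forall c d, 0 < c -> c <= d -> \int[mu]_(x in `]c, d]) f x = 0.
Proof.
move=> lf f0 c d c0 cd.
have scd := @segment_sub_Rplus _ c d c0.
have [mf /(_ c d c0 cd) icd] := (locally_integrable_segmentP f).1 lf.
have mfcd : measurable_fun `[c, d] f.
  by apply: measurable_funS mf => //; exact: measurable_Rplus.
have ioo : mu.-integrable `]c, d[ (EFin \o f).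
  by apply: integrableS icd => //; apply: subset_itv; rewrite bnd_simp.
have ioc : mu.-integrable `]c, d] (EFin \o f).
  by apply: integrableS icd => //; apply: subset_itv; rewrite bnd_simp.
have mfoo : measurable_fun `]c, d[ f by move/integrableP : ioo => [/measurable_EFinP].
rewrite -Rintegral_itv_bndo_bndc//.
have cp n : continuous (plateau c d n).
  by apply: smooth_continuous; exact: plateau_smooth.
have H : (\int[mu]_(x in `]c, d[) (f x * plateau c d n x)%:E)%E @[n --> \oo] -->
    (\int[mu]_(x in `]c, d[) (f x)%:E)%E.
  apply: (@dominated_cvg _ _ _ mu `]c, d[%classic _ _ _ (fun x => `|(f x)%:E|)%E) => //.
  - move=> n; apply/measurable_EFinP; apply: measurable_funM => //.
    by apply: measurable_funTS; exact: continuous_measurable_fun.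
  - move=> x /=; rewrite in_itv/= => xcd; apply/cvg_EFin; first exact: nearW.
    rewrite -[X in _ --> X]mulr1; apply: cvgM; first exact: cvg_cst.
    exact: plateau_cvg.
  - exact: integrable_abse.
  - move=> n x _; rewrite lee_fin normrM -[leRHS]mulr1 ler_wpM2l//.
    by have /andP[p0 p1] := plateau_bound c d n x; rewrite ger0_norm.
have E n : (\int[mu]_(x in `]c, d[) (f x * plateau c d n x)%:E = 0)%E.
  have ifp : mu.-integrable `[c, d] (EFin \o (fun x => f x * plateau c d n x)).
    apply: (@integrable_mul_bounded _ _ _ _ 1) => //.
    - by apply: measurable_funTS; exact: continuous_measurable_fun.
    - by move=> x _; have /andP[p0 p1] := plateau_bound c d n x; rewrite ger0_norm.
  have := f0 _ _ _ (@plateau_smooth _ c d n) c0 cd (@plateau_supported _ c d n).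
  rewrite (@supported_Rintegral _ c d)//; last first.
    by move=> x xcd; rewrite plateau_supported ?mulr0.
  rewrite -Rintegral_itv_obnd_cbnd; last first.
    by apply: integrableS ifp => //; apply: subset_itv; rewrite bnd_simp.
  rewrite -Rintegral_itv_bndo_bndc; last first.
    by apply: integrableS ifp => //; apply: subset_itv; rewrite bnd_simp.
  rewrite /Rintegral => Z; rewrite -[LHS]fineK ?Z//.
  apply: integrable_fin_num => //.
  by apply: integrableS ifp => //; apply: subset_itv; rewrite bnd_simp.
rewrite /Rintegral; suff -> : (\int[mu]_(x in `]c, d[) (f x)%:E = 0)%E by [].
by rewrite -(cvg_lim _ H)//; under eq_fun do rewrite E; exact: lim_cst.
Qed.

(** The restriction of [f] to ]a, b] is a density of the zero function, hence is a.e. equal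
    to its derivative. *)
Lemma fundamental_lemma f : locally_integrable Rplus f ->
  (forall phi a b, smooth phi -> 0 < a -> a <= b -> supported_in a b phi ->
    \int[mu]_(x in Rplus) (f x * phi x) = 0) ->
  {ae mu, forall x, 0 < x -> f x = 0}.
Proof.
move=> lf /(plateau_Rintegral0 lf) f0.
have [mf fab] := (locally_integrable_segmentP f).1 lf.
apply: ae_Rplus => a b a0 ab.
pose r := f \_ `]a, b].
have ioc : mu.-integrable `]a, b] (EFin \o f).
  by apply: integrableS (fab a b a0 ab) => //; apply: subset_itv; rewrite bnd_simp.
have ir : mu.-integrable setT (EFin \o r).
  by rewrite /r -restrict_EFin; apply/(integrable_mkcond _ _).1.
have rE x : a <= x <= b -> (cst 0 : R -> R) x - cst 0 a = \int[mu]_(t in `]a, x]) r t.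
  move=> /andP[ax xb]; rewrite subrr; apply/esym.
  rewrite -[RHS](f0 a x a0 ax); apply: eq_Rintegral => t; rewrite inE /= in_itv/= => /andP[at_ tx].
  by rewrite /r patchE mem_set//= in_itv/= at_ (le_trans tx).
apply: ae_mono (abs_continuous_derive_ae ir rE) => x H xab.
have [_] := H xab; rewrite derive_cst /r patchE mem_set//=.
by rewrite in_itv/=; case/andP : xab => -> /ltW ->.
Qed.

End fundamental_lemma.

(** * Complex-valued functions and regular distributions *)

Section complex_functions.
Local Open Scope complex_scope.
Context {R : realType}.
Notation mu := (@lebesgue_measure R).
Implicit Types (f g h sigma phi : R -> R[i]) (k n : nat).

Lemma ReFD f g : ReF (fun x => f x + g x) = (fun x => ReF f x + ReF g x).
Proof. by apply/funext => x; rewrite /ReF; case: (f x); case: (g x). Qed.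
Lemma ImFD f g : ImF (fun x => f x + g x) = (fun x => ImF f x + ImF g x).
Proof. by apply/funext => x; rewrite /ImF; case: (f x); case: (g x). Qed.
Lemma ReFM f g :
  ReF (fun x => f x * g x) = (fun x => ReF f x * ReF g x - ImF f x * ImF g x).
Proof. by apply/funext => x; rewrite /ReF /ImF; case: (f x); case: (g x). Qed.
Lemma ImFM f g :
  ImF (fun x => f x * g x) = (fun x => ReF f x * ImF g x + ImF f x * ReF g x).
Proof. by apply/funext => x; rewrite /ReF /ImF; case: (f x); case: (g x). Qed.

Lemma ReF_cderive k f : ReF (cderive k f) = derive1n k (ReF f).
Proof. by []. Qed.
Lemma ImF_cderive k f : ImF (cderive k f) = derive1n k (ImF f).
Proof. by []. Qed.

Lemma cderiveD j k f : cderive j (cderive k f) = cderive (j + k) f.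
Proof.
by apply/funext => x; rewrite /cderive ReF_cderive ImF_cderive /derive1n !iterD.
Qed.

Lemma test_functionP phi : test_function phi <->
  [/\ smooth (ReF phi), smooth (ImF phi) & exists a b : R, [/\ 0 < a, a <= b,
     supported_in a b (ReF phi) & supported_in a b (ImF phi)]].
Proof.
split=> [[sphi [a [b [a0 ab phi0]]]]|[sr si [a [b [a0 ab rphi iphi]]]]].
  split; [by move=> k x; case: (sphi k x)..|].
  by exists a, b; split => // x /phi0 px; rewrite /ReF /ImF px.
split; first by move=> k x; split; [exact: sr|exact: si].
exists a, b; split => // x xab.
by apply/eqP; rewrite eq_complex/=; apply/andP; split; apply/eqP; [exact: rphi|exact: iphi].
Qed.

Lemma supported_derive1n a b k (u : R -> R) :
  supported_in a b u -> supported_in a b (derive1n k u).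
Proof. by move=> su; elim: k => //= k ih; exact: supported_derive. Qed.

Lemma test_cderive k phi : test_function phi -> test_function (cderive k phi).
Proof.
move=> /test_functionP[sr si [a [b [a0 ab rphi iphi]]]]; apply/test_functionP.
rewrite ReF_cderive ImF_cderive; split; [exact: smooth_derive1n..|].
by exists a, b; split => //; exact: supported_derive1n.
Qed.

(** The real bilinear form behind [regular]: all statements on complex distributions
    reduce to it by taking real and imaginary parts. *)
Definition pairing (u v : R -> R) : R := \int[mu]_(x in Rplus) (u x * v x).

Definition real_test_function (v : R -> R) := smooth v /\
  exists a b : R, [/\ 0 < a, a <= b & supported_in a b v].

Lemma test_Re phi : test_function phi -> real_test_function (ReF phi).
Proof.
by move=> /test_functionP[? ? [a [b [? ? ? ?]]]]; split => //; exists a, b.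
Qed.
Lemma test_Im phi : test_function phi -> real_test_function (ImF phi).
Proof.
by move=> /test_functionP[? ? [a [b [? ? ? ?]]]]; split => //; exists a, b.
Qed.

Lemma real_test_integrable (u v : R -> R) : locally_integrable Rplus u ->
  real_test_function v -> mu.-integrable Rplus (EFin \o (fun x => u x * v x)).
Proof.
move=> lu [sv [a [b [a0 ab vab]]]].
by apply: (@supported_integrable _ a b) => //; exact: smooth_continuous.
Qed.

(** Splitting the integral of a product into real and imaginary parts needs the
    integrability of each of the four real products. *)
Lemma regularE f phi : L1_loc f -> test_function phi ->
  regular f phi = (pairing (ReF f) (ReF phi) - pairing (ImF f) (ImF phi)) +i*
    (pairing (ReF f) (ImF phi) + pairing (ImF f) (ReF phi)).
Proof.
move=> [fr fi] tphi; have tr := test_Re tphi; have ti := test_Im tphi.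
rewrite /regular /cintegral ReFM ImFM; congr (_ +i* _).
  rewrite RintegralB//; first exact: measurable_Rplus.
  - exact: real_test_integrable.
  - exact: real_test_integrable.
rewrite RintegralD//; first exact: measurable_Rplus.
- exact: real_test_integrable.
- exact: real_test_integrable.
Qed.

Lemma L1_locD f g : L1_loc f -> L1_loc g -> L1_loc (fun x => f x + g x).
Proof.
move=> [fr fi] [gr gi]; split; rewrite ?ReFD ?ImFD; exact: locally_integrableD.
Qed.

Lemma continuous_cst_Rplus (c : R) : {in Rplus, continuous (cst c : R -> R)}.
Proof. by move=> x _; exact: cvg_cst. Qed.

Lemma L1_locZ (c : R[i]) f : L1_loc f -> L1_loc (fun x => c * f x).
Proof.
move=> [fr fi]; split.
- rewrite (_ : ReF _ = (fun x => ReF f x * complex.Re c) \- (fun x => ImF f x * complex.Im c)).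
    by apply: locally_integrableB; apply: locally_integrableM_continuous => //;
      exact: continuous_cst_Rplus.
  by apply/funext => x; rewrite (ReFM (cst c)) /= mulrC [_ * ImF _ _]mulrC.
- rewrite (_ : ImF _ = (fun x => ImF f x * complex.Re c) \+ (fun x => ReF f x * complex.Im c)).
    by apply: locally_integrableD; apply: locally_integrableM_continuous => //;
      exact: continuous_cst_Rplus.
  by apply/funext => x; rewrite (ImFM (cst c)) /= mulrC [_ * ReF _ _]mulrC.
Qed.

Lemma L1_loc0 : L1_loc (fun=> 0 : R[i]).
Proof.
by split; apply: continuous_locally_integrable; exact: continuous_cst_Rplus.
Qed.

Lemma L1_loc_sum (J : Type) (r : seq J) (P : pred J) (F : J -> R -> R[i]) :
  (forall j, P j -> L1_loc (F j)) -> L1_loc (fun x => \sum_(j <- r | P j) F j x).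
Proof.
move=> LF; elim: r => [|j r ih].
  by under eq_fun do rewrite big_nil; exact: L1_loc0.
case Pj : (P j); under eq_fun do rewrite big_cons Pj; last by [].
by apply: L1_locD => //; exact: LF.
Qed.

Lemma regularD f g phi : L1_loc f -> L1_loc g -> test_function phi ->
  regular (fun x => f x + g x) phi = regular f phi + regular g phi.
Proof.
move=> Lf Lg tphi; rewrite !regularE//; last exact: L1_locD.
case: Lf Lg => [fr fi] [gr gi]; have tr := test_Re tphi; have ti := test_Im tphi.
have pairingD (u v w : R -> R) : locally_integrable Rplus u -> locally_integrable Rplus v ->
    real_test_function w -> pairing (fun x => u x + v x) w = pairing u w + pairing v w.
  move=> lu lv tw; rewrite /pairing; under eq_Rintegral do rewrite mulrDl.
  rewrite RintegralD//; first exact: measurable_Rplus.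
  - exact: real_test_integrable.
  - exact: real_test_integrable.
rewrite ReFD ImFD !pairingD//.
by apply/eqP; rewrite eq_complex/=; apply/andP; split; apply/eqP; ring.
Qed.

Lemma regularZ (c : R[i]) f phi : L1_loc f -> test_function phi ->
  regular (fun x => c * f x) phi = c * regular f phi.
Proof.
move=> Lf tphi; rewrite !regularE//; last exact: L1_locZ.
case: Lf => [fr fi]; have tr := test_Re tphi; have ti := test_Im tphi.
have pairing_lin (s t : R) (u v w : R -> R) : locally_integrable Rplus u ->
    locally_integrable Rplus v -> real_test_function w ->
    pairing (fun x => s * u x + t * v x) w = s * pairing u w + t * pairing v w.
  move=> lu lv tw; rewrite /pairing.
  under eq_Rintegral do rewrite mulrDl -!mulrA.
  have iu := real_test_integrable lu tw; have iv := real_test_integrable lv tw.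
  rewrite RintegralD; first by rewrite !RintegralZl//; exact: measurable_Rplus.
  - exact: measurable_Rplus.
  - by apply: (integrableZl _ s iu); exact: measurable_Rplus.
  - by apply: (integrableZl _ t iv); exact: measurable_Rplus.
have -> : ReF (fun x => c * f x) = fun x => complex.Re c * ReF f x + (- complex.Im c) * ImF f x.
  by rewrite (ReFM (cst c)); apply/funext => x; rewrite mulNr.
have -> : ImF (fun x => c * f x) = fun x => complex.Re c * ImF f x + complex.Im c * ReF f x.
  by rewrite (ImFM (cst c)).
rewrite !pairing_lin//; case: c => s t.
by apply/eqP; rewrite eq_complex/=; apply/andP; split; apply/eqP; ring.
Qed.

Lemma regular_sum (J : Type) (r : seq J) (P : pred J) (F : J -> R -> R[i]) phi :
  (forall j, P j -> L1_loc (F j)) -> test_function phi ->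
  regular (fun x => \sum_(j <- r | P j) F j x) phi =
  \sum_(j <- r | P j) regular (F j) phi.
Proof.
move=> LF tphi; elim: r => [|j r ih].
  under [in LHS]eq_fun do rewrite big_nil.
  rewrite big_nil -[RHS](mul0r (regular (fun=> 0) phi)) -regularZ//; last exact: L1_loc0.
  by congr regular; apply/funext => x; rewrite mul0r.
case Pj : (P j); under [in LHS]eq_fun do rewrite big_cons Pj; rewrite big_cons Pj; last by [].
by rewrite regularD ?ih//; [exact: LF|exact: L1_loc_sum].
Qed.

Definition measurable_Rplus_fun f :=
  measurable_fun Rplus (ReF f) /\ measurable_fun Rplus (ImF f).

Lemma L1_loc_measurable f : L1_loc f -> measurable_Rplus_fun f.
Proof. by move=> [[? _ _] [? _ _]]. Qed.

Lemma measurable_Rplus_funM f g : measurable_Rplus_fun f -> measurable_Rplus_fun g ->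
  measurable_Rplus_fun (fun x => f x * g x).
Proof.
move=> [? ?] [? ?]; split; rewrite ?ReFM ?ImFM.
- by apply: measurable_funB; exact: measurable_funM.
- by apply: measurable_funD; exact: measurable_funM.
Qed.

(** Only measurability is required, because this lemma is applied to products before
    they are known to be locally integrable. *)
Lemma regular_ae f g phi : measurable_Rplus_fun f -> measurable_Rplus_fun g ->
  ae_eq_on_Rplus f g -> test_function phi -> regular f phi = regular g phi.
Proof.
move=> mf mg fg tphi.
have mphi : measurable_Rplus_fun phi.
  have [[sr _] [si _]] := (test_Re tphi, test_Im tphi).
  by split; apply: measurable_funTS; apply: continuous_measurable_fun; exact: smooth_continuous.
have [fr fi] := measurable_Rplus_funM mf mphi.
have [gr gi] := measurable_Rplus_funM mg mphi.
rewrite /regular /cintegral; congr (_ +i* _); apply: ae_eq_Rintegral => //.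
- exact: measurable_Rplus.
- by apply: ae_mono fg => x H; rewrite /Rplus /= in_itv/= andbT /ReF => /H ->.
- exact: measurable_Rplus.
- by apply: ae_mono fg => x H; rewrite /Rplus /= in_itv/= andbT /ImF => /H ->.
Qed.

Lemma locally_abs_continuousP h : AC_loc h <->
  locally_abs_continuous (ReF h) /\ locally_abs_continuous (ImF h).
Proof.
split=> [H|[H1 H2] a b a0 ab]; last by split; [exact: H1|exact: H2].
by split=> a b a0 ab; case: (H _ _ a0 ab).
Qed.

(** The derivative computed a.e. has to be replaced by a measurable representative before
    it can serve as a density. *)
Lemma AC_loc_density h : AC_loc h -> exists rho, [/\ L1_loc rho,
  ae_eq_on_Rplus rho (cderive 1 h) &
  forall phi, test_function phi -> regular h (cderive 1 phi) = - regular rho phi].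
Proof.
move=> /locally_abs_continuousP[hr hi].
have [r [lr dr]] := locally_abs_continuous_density hr.
have [s [ls ds]] := locally_abs_continuous_density hi.
exists (fun x => r x +i* s x); split => //.
- apply: ae_mono (ae_and dr ds) => x [Hr Hi] x0.
  have [_ dR] := Hr x0; have [_ dI] := Hi x0.
  by rewrite /cderive /derive1n /= !derive1E dR dI.
- move=> phi tphi; have tphi1 := test_cderive 1 tphi.
  rewrite !regularE//; last first.
    split; apply: continuous_locally_integrable; exact: locally_abs_continuous_continuous.
  have [sr si [a [b [a0 ab rphi iphi]]]] := (test_functionP _).1 tphi.
  have ibp (u v w : R -> R) : locally_abs_continuous u -> locally_integrable Rplus v ->
      {ae mu, forall x : R, 0 < x -> is_derive x 1 u (v x)} -> smooth w ->
      supported_in a b w -> pairing u (derive1n 1 w) = - pairing v w.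
    move=> hu lv duv sw wab; apply: integration_by_parts_test hu lv duv a0 ab _ _ wab.
      exact: (sw 0%N).
    exact/smooth_continuous/smooth_derive.
  rewrite ReF_cderive ImF_cderive.
  rewrite (ibp _ _ _ hr lr dr sr rphi) (ibp _ _ _ hr lr dr si iphi).
  rewrite (ibp _ _ _ hi ls ds sr rphi) (ibp _ _ _ hi ls ds si iphi).
  by apply/eqP; rewrite eq_complex/=; apply/andP; split; apply/eqP; rewrite /ReF/ImF/=; ring.
Qed.

(** Testing against real-valued functions separates real and imaginary parts, and the
    fundamental lemma applies to the difference of each. *)
Lemma has_density_unique T f g : has_density T f -> has_density T g ->
  ae_eq_on_Rplus f g.
Proof.
move=> [Lf Tf] [Lg Tg].
have key (v : R -> R) : real_test_function v ->
    pairing (ReF f) v = pairing (ReF g) v /\ pairing (ImF f) v = pairing (ImF g) v.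
  move=> [sv [a [b [a0 ab vab]]]].
  have tv : test_function (fun x => v x +i* 0).
    apply/test_functionP; split => //.
      by apply: diffn_smooth => k; exact: (diffn_cst k 0).
    by exists a, b; split.
  have := Tf _ tv; rewrite (Tg _ tv) !regularE// => -[].
  have pairing_im0 u : pairing u (ImF (fun x => v x +i* 0)) = 0.
    rewrite /pairing; under eq_Rintegral do rewrite mulr0.
    by rewrite /Rintegral integral0.
  by rewrite !pairing_im0 !subr0 !add0r => -> ->.
have real (u w : R -> R) : locally_integrable Rplus u -> locally_integrable Rplus w ->
    (forall v, real_test_function v -> pairing u v = pairing w v) ->
    {ae mu, forall x : R, 0 < x -> u x = w x}.
  move=> lu lw uw.
  have : {ae mu, forall x : R, 0 < x -> u x - w x = 0}.
    apply: (@fundamental_lemma _ (u \- w)); first exact: locally_integrableB.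
    move=> v a b sv a0 ab vab.
    have tv : real_test_function v by split => //; exists a, b.
    under eq_Rintegral do rewrite /= mulrBl.
    rewrite RintegralB; last first.
    - exact: real_test_integrable.
    - exact: real_test_integrable.
    - exact: measurable_Rplus.
    by have := uw _ tv; rewrite /pairing => ->; rewrite subrr.
  by apply: ae_mono => x H x0; apply/eqP; rewrite -subr_eq0 H.
have [fr fi] := Lf; have [gr gi] := Lg.
have h1 := real _ _ fr gr (fun v tv => (key v tv).1).
have h2 := real _ _ fi gi (fun v tv => (key v tv).2).
apply: ae_mono (ae_and h1 h2) => x [H1 H2] x0.
by apply/eqP; rewrite eq_complex; apply/andP; split; apply/eqP; [exact: H1|exact: H2].
Qed.

(** The density chosen by [dist_mul] agrees a.e. with any other one. *)
Lemma dist_mulE sigma T f phi : measurable_Rplus_fun sigma -> has_density T f ->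
  test_function phi -> dist_mul sigma T phi = regular (fun x => sigma x * f x) phi.
Proof.
move=> ms Tf tphi.
have Td : has_density T (density T) by apply: xgetPex; exists f.
apply: regular_ae => //.
- by apply: measurable_Rplus_funM => //; apply: L1_loc_measurable; case: Td.
- by apply: measurable_Rplus_funM => //; apply: L1_loc_measurable; case: Tf.
- by apply: ae_mono (has_density_unique Td Tf) => x H /H ->.
Qed.

Lemma AC_loc_continuous h : AC_loc h ->
  {in Rplus, continuous (ReF h)} /\ {in Rplus, continuous (ImF h)}.
Proof.
by move=> /locally_abs_continuousP[hr hi]; split; exact: locally_abs_continuous_continuous.
Qed.

Lemma L1_locM_AC f h : L1_loc f -> AC_loc h -> L1_loc (fun x => f x * h x).
Proof.
move=> [fr fi] /AC_loc_continuous[hr hi]; split; rewrite ?ReFM ?ImFM.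
- by apply: locally_integrableB; exact: locally_integrableM_continuous.
- by apply: locally_integrableD; exact: locally_integrableM_continuous.
Qed.

Lemma L1_locM_L2 f g : L2_loc f -> L2_loc g -> L1_loc (fun x => f x * g x).
Proof.
move=> [? ? ? ?] [? ? ? ?]; split; rewrite ?ReFM ?ImFM.
- by apply: locally_integrableB; exact: locally_integrableM_square.
- by apply: locally_integrableD; exact: locally_integrableM_square.
Qed.

Lemma locally_square_integrableD (u v : R -> R) : 
  measurable_fun Rplus u -> measurable_fun Rplus v ->
  locally_integrable Rplus (fun x => u x ^+ 2) ->
  locally_integrable Rplus (fun x => v x ^+ 2) ->
  locally_integrable Rplus (fun x => (u x + v x) ^+ 2).
Proof.
move=> mu_ mv u2 v2; have uv := locally_integrableM_square mu_ mv u2 v2.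
rewrite (_ : (fun x => _) = ((fun x => u x ^+ 2) \+ (fun x => v x ^+ 2)) \+
  ((fun x => u x * v x) \+ (fun x => u x * v x))).
  by do 2 apply: locally_integrableD => //; apply: locally_integrableD.
by apply/funext => x /=; ring.
Qed.

Lemma locally_square_integrableM (u v : R -> R) : 
  locally_integrable Rplus (fun x => u x ^+ 2) -> {in Rplus, continuous v} ->
  locally_integrable Rplus (fun x => (u x * v x) ^+ 2).
Proof.
move=> u2 cv; under eq_fun do rewrite exprMn.
apply: locally_integrableM_continuous => // x xR.
by under eq_fun do rewrite expr2; apply: cvgM; exact: cv.
Qed.

Lemma L2_locD f g : L2_loc f -> L2_loc g -> L2_loc (fun x => f x + g x).
Proof.
move=> [? ? ? ?] [? ? ? ?]; split; rewrite ?ReFD ?ImFD.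
- exact: measurable_funD.
- exact: measurable_funD.
- exact: locally_square_integrableD.
- exact: locally_square_integrableD.
Qed.

(** A continuous factor preserves local square integrability of each of the two real
    products that make up the real or imaginary part. *)
Lemma L2_locM_AC f h : L2_loc f -> AC_loc h -> L2_loc (fun x => f x * h x).
Proof.
move=> [mfr mfi f2r f2i] /AC_loc_continuous[hr hi].
have mhr : measurable_fun Rplus (ReF h).
  by apply: open_continuous_measurable_fun => //; exact: open_Rplus.
have mhi : measurable_fun Rplus (ImF h).
  by apply: open_continuous_measurable_fun => //; exact: open_Rplus.
split; rewrite ?ReFM ?ImFM.
- by apply: measurable_funB; exact: measurable_funM.
- by apply: measurable_funD; exact: measurable_funM.
- rewrite (_ : (fun x => _) = (fun x => (ReF f x * ReF h x + ImF f x * - ImF h x) ^+ 2)).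
    apply: locally_square_integrableD.
    + exact: measurable_funM.
    + by apply: measurable_funM => //; exact: measurableT_comp.
    + exact: locally_square_integrableM.
    + by apply: locally_square_integrableM => // x xR; apply: cvgN; exact: hi.
  by apply/funext => x; rewrite mulrN.
- apply: locally_square_integrableD.
  + exact: measurable_funM.
  + exact: measurable_funM.
  + exact: locally_square_integrableM.
  + exact: locally_square_integrableM.
Qed.

Lemma AC_loc_cst (c : R[i]) : AC_loc (cst c).
Proof.
apply/locally_abs_continuousP; split => a b _ _;
by apply: C1_abs_continuous => [x|x]; [exact: derivable_cst|];
   rewrite (_ : derive1 _ = cst 0); [exact: cvg_cst|];
   apply/funext => y; rewrite derive1E derive_cst.
Qed.

Lemma L2_locZ (c : R[i]) f : L2_loc f -> L2_loc (fun x => c * f x).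
Proof.
move=> Lf; have := L2_locM_AC Lf (AC_loc_cst c).
by rewrite (_ : (fun x => f x * _) = (fun x => c * f x))//; apply/funext => x; rewrite mulrC.
Qed.

Lemma AC_loc_L2 h : AC_loc h -> L2_loc h.
Proof.
move=> hAC; have L1 : L2_loc (cst 1 : R -> R[i]).
  have rE : ReF (cst 1 : R -> R[i]) = cst 1 by [].
  have iE : ImF (cst 1 : R -> R[i]) = cst 0 by [].
  have lc (c : R) : locally_integrable Rplus (fun=> c).
    by apply: continuous_locally_integrable; exact: continuous_cst_Rplus.
  by split; rewrite ?rE ?iE;
    [exact: measurable_cst|exact: measurable_cst|exact: (lc (1 ^+ 2))|exact: (lc (0 ^+ 2))].
have := L2_locM_AC L1 hAC.
by rewrite (_ : (fun x => _) = h)//; apply/funext => x; rewrite mul1r.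
Qed.

Lemma AC_loc_L1 h : AC_loc h -> L1_loc h.
Proof.
by move=> /AC_loc_continuous[hr hi]; split; exact: continuous_locally_integrable.
Qed.

Lemma L2_loc_sum (J : Type) (r : seq J) (P : pred J) (F : J -> R -> R[i]) :
  (forall j, P j -> L2_loc (F j)) -> L2_loc (fun x => \sum_(j <- r | P j) F j x).
Proof.
move=> LF; elim: r => [|j r ih].
  by under eq_fun do rewrite big_nil; exact/AC_loc_L2/AC_loc_cst.
case Pj : (P j); under eq_fun do rewrite big_cons Pj; last by [].
by apply: L2_locD => //; exact: LF.
Qed.

End complex_functions.

(** * The algebra of the matrices Q and F *)

Section quasi_derivatives.
Local Open Scope complex_scope.
Context {R : realType}.
Context (n : nat) (I : nat -> nat) (Sigma : nat -> R -> R[i]).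
Context (n2 : (2 <= n)%N) (hI : singularity_orders n I).
Local Notation m := n./2.
Implicit Types (nu s k j r : nat) (x : R).

Lemma nE : n = (odd n + m.*2)%N. Proof. by rewrite odd_double_half. Qed.

Lemma m_gt0 : (0 < m)%N. Proof. by lia. Qed.

(** The number of derivatives that the Leibniz rule distributes: i_nu for even nu and
    i_nu + 1 for odd nu.  With [leibniz_coef] it treats both parities at once. *)
Definition leibniz_order nu := (I nu + odd nu)%N.

Definition leibniz_coef nu s : R[i] :=
  if odd nu then coef_odd (I nu) s else coef_even (I nu) s.

Lemma half_lt nu : (nu < n.-1)%N -> (nu./2 < m)%N.
Proof. by lia. Qed.

(** This is the constraint on the singularity orders, for both parities; it keeps all
    rows, columns and orders of derivatives at most m. *)
Lemma leibniz_order_le nu : (nu < n.-1)%N -> (leibniz_order nu + nu./2 <= m)%N.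
Proof.
move=> nun; have [h0 h1] := hI; have k0 := half_lt nun.
have := odd_double_half nu; rewrite /leibniz_order; case: (boolP (odd nu)) => onu e.
  have e1 : nu./2.*2.+1 = nu := e.
  have := h1 nu./2; rewrite e1.
  have -> : (nu./2 < (n./2 + odd n).-1)%N by move: nun e; rewrite {1}nE; lia.
  by move=> /(_ isT); lia.
have e0 : nu./2.*2 = nu := e.
have := h0 nu./2 k0; rewrite e0.
by lia.
Qed.

(** Membership in K(I) is the case of equality in [leibniz_order_le]. *)
Lemma in_KP nu : ~~ odd n -> (nu < n.-1)%N -> (leibniz_order nu + nu./2 = m)%N -> in_K n I nu.
Proof.
move=> on nun; rewrite /leibniz_order /in_K on nun /=; have := half_lt nun.
by case: (odd nu) => /= h1 h2; apply/eqP; lia.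
Qed.

Lemma chiE nu (j r : 'I_m.+1) : chi m nu (I nu) j r =
  \sum_(s < (leibniz_order nu).+1 |
     (j == s + nu./2 :> nat)%N && (r == leibniz_order nu - s + nu./2 :> nat)%N)
    leibniz_coef nu s :> R[i].
Proof.
rewrite mxE /leibniz_order /leibniz_coef; case: (odd nu) => /=; first by rewrite addn1.
by rewrite addn0.
Qed.

Definition Qentry x j r : R[i] := Qmatrix n I Sigma x (inord j) (inord r).

Lemma QentryE x j r : (j <= m)%N -> (r <= m)%N -> Qentry x j r =
  \sum_(nu < n.-1) \sum_(s < (leibniz_order nu).+1 |
     (j == s + nu./2)%N && (r == leibniz_order nu - s + nu./2)%N) leibniz_coef nu s * Sigma nu x.
Proof.
move=> jm rm; rewrite /Qentry /Qmatrix summxE; apply: eq_bigr => nu _.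
by rewrite mxE chiE !inordK// mulr_sumr; apply: eq_bigr => s _; rewrite mulrC.
Qed.

(** The row index m forces s = m - k and the column index m forces s = 0, where k is the
    half of nu, so that k = m, which is too large. *)
Lemma Qentry_diag0 x : Qentry x m m = 0.
Proof.
rewrite QentryE//; apply: big1 => nu _; apply: big_pred0 => s.
apply/negP => /andP[/eqP h1 /eqP h2].
have := leibniz_order_le (ltn_ord nu); have := half_lt (ltn_ord nu); have := ltn_ord s.
lia.
Qed.

Section perturbations.
Context (Y : nat -> R -> R[i]).

(** The function u_j that represents D^j y for j <= m.  It is the quasi-derivative of order
    j, except at the top order j = m for even n, where the definition of y^[m] is solved
    for the ordinary derivative. *)
Definition deriv_repr j x : R[i] :=
  if odd n || (j < m)%N then Y j x
  else Y j x - (-1) ^+ m * \sum_(i < m) Qentry x i m * Y i x.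

(** The function V_r to which the expression applies (-1)^r D^r.  It is defined from the
    terms of the Leibniz rules, not from the entries of Q, because the products that occur
    here are all locally integrable. *)
Definition perturbation r x : R[i] :=
  \sum_(nu < n.-1) \sum_(s < (leibniz_order nu).+1 | (r == leibniz_order nu - s + nu./2)%N)
    leibniz_coef nu s * (Sigma nu x * deriv_repr (s + nu./2) x).

Lemma perturbationE r x : (r <= m)%N ->
  perturbation r x = \sum_(j < m.+1) Qentry x j r * deriv_repr j x.
Proof.
move=> rm; under [RHS]eq_bigr => j _ do rewrite QentryE ?leq_ord// mulr_suml.
rewrite exchange_big/=; apply: eq_bigr => nu _.
under [RHS]eq_bigr => j _ do rewrite mulr_suml.
rewrite (exchange_big_dep (fun s : 'I_(leibniz_order nu).+1 =>
  r == leibniz_order nu - s + nu./2)%N)/=; last first.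
  by move=> j s _ /andP[].
apply: eq_bigr => s rs.
have sm : (s + nu./2 < m.+1)%N.
  by have := leibniz_order_le (ltn_ord nu); have := ltn_ord s; lia.
rewrite (big_pred1 (Ordinal sm))/=; first by rewrite mulrA.
by move=> j /=; rewrite rs andbT -val_eqE.
Qed.

Lemma perturbation0 r x : (m < r)%N -> perturbation r x = 0.
Proof.
move=> mr; apply: big1 => nu _; apply: big_pred0 => s; apply/negP => /eqP h.
by have := leibniz_order_le (ltn_ord nu); lia.
Qed.

Lemma big_ord_shrink (N M : nat) (P : pred nat) (f : nat -> R[i]) :
  (M <= N)%N -> (forall j, (j < N)%N -> (M <= j)%N -> P j -> f j = 0) ->
  \sum_(j < N | P j) f j = \sum_(j < M | P j) f j.
Proof.
move=> MN f0; rewrite (big_ord_widen_cond N P f MN) [LHS]big_mkcond [RHS]big_mkcond.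
apply: eq_bigr => j _; case: (boolP (P j)) => //= Pj.
by case: ltnP => // Mj; rewrite f0.
Qed.

(** The k-th row of F gives - (-1)^r V_r with r = n-k-1.  For even n and k >= m, the part of
    the row that is quadratic in Q combines with the entry in column m into the term of
    V_r that contains u_m. *)
Lemma row_identity (k : 'I_n) x :
  \sum_(j < n | (j <= k)%N) Fmatrix n I Sigma x k j * Y j x =
  - (-1) ^+ (n - k.+1) * perturbation (n - k.+1) x.
Proof.
have kn := ltn_ord k.
(* [f j] is the contribution of column j to the row; it vanishes for j > m. *)
have [on|on] := boolP (odd n).
  pose f j := if (m <= k)%N && (j <= m)%N then (-1) ^+ k.+1 * Qentry x j (n - k.+1) * Y j x else 0.
  rewrite (eq_bigr (fun j : 'I_n => f j)); last first.
    move=> j jk; rewrite /Fmatrix /Smap mxE /= on /f ltnS ltnS.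
    by rewrite ifF; [case: ifP; rewrite ?mul0r|apply/negbTE; lia].
  have [km|mk] := ltnP k m.
    rewrite perturbation0 ?mulr0; last by lia.
    by apply: big1 => j _; rewrite /f leqNgt km.
  rewrite (@big_ord_shrink n m.+1 (fun j => j <= k)%N f); last 2 first.
  - lia.
  - by move=> j _ mj _; rewrite /f [(j <= m)%N]leqNgt mj andbF.
  rewrite perturbationE; last by lia.
  rewrite mulr_sumr; apply: eq_big => j; first by have := ltn_ord j; lia.
  move=> _; rewrite /f mk -ltnS ltn_ord /= /deriv_repr on mulrA; congr (_ * _ * _).
  rewrite -signr_odd -[in RHS]signr_odd oddB//= on /=;
    case: (odd k); rewrite ?expr0 ?expr1 ?opprK//.
have nm : n = m.*2 by have := nE; rewrite (negbTE on).
pose f j := (if (k.+1 == m) && (j < m)%N then (-1) ^+ m.+1 * Qentry x j m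
  else if (m <= k)%N && (j == m) then (-1) ^+ k.+2 * Qentry x m (n - k.+1)
  else if (m <= k)%N && (j < m)%N then (-1) ^+ k.+2 * Qentry x j (n - k.+1)
     + (-1) ^+ (m + k.+1) * Qentry x j m * Qentry x m (n - k.+1)
  else 0) * Y j x.
rewrite (eq_bigr (fun j : 'I_n => f j)); last first.
  move=> j jk; rewrite /Fmatrix /Smap mxE /= (negbTE on) /f !ltnS !eqSS.
  by rewrite ifF; [rewrite //|apply/negbTE; lia].
have [km|mk] := ltnP k m; last first.
  rewrite (@big_ord_shrink n m.+1 (fun j => j <= k)%N f); last 2 first.
  - lia.
  - move=> j _ mj _; rewrite /f; do 3 (rewrite ifF; last by apply/negbTE; lia).
    by rewrite mul0r.
  rewrite perturbationE; last by lia.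
  rewrite (eq_bigl xpredT); last by move=> j; have := ltn_ord j; lia.
  rewrite !big_ord_recr/=.
  have fm : f m = (-1) ^+ k * Qentry x m (n - k.+1) * Y m x.
    by rewrite /f eqxx mk ltnn andbF /= !exprS; ring.
  rewrite fm [deriv_repr m x]/deriv_repr (negbTE on) ltnn /=.
  have fj (j : 'I_m) : f j = (-1) ^+ k * (Qentry x j (n - k.+1) * deriv_repr j x) -
      (-1) ^+ k * (-1) ^+ m * Qentry x m (n - k.+1) * (Qentry x j m * Y j x).
    rewrite /f ltn_ord mk /deriv_repr ltn_ord orbT.
    rewrite ifF; last by apply/negbTE; lia.
    rewrite ifF; last by apply/negbTE; have := ltn_ord j; lia.
    by rewrite /= !exprD !exprS; ring.
  under eq_bigr do rewrite fj.
  rewrite sumrB -!mulr_sumr.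
  have -> : (-1) ^+ (n - k.+1) = - (-1) ^+ k :> R[i].
    rewrite -signr_odd -[in RHS]signr_odd oddB//= (negbTE on) /=.
    by case: (odd k); rewrite ?expr0 ?expr1 ?opprK.
  by ring.
have [km1|km1] := eqVneq k.+1 m; last first.
  rewrite perturbation0 ?mulr0; last by lia.
  by apply: big1 => j _; rewrite /f (negbTE km1) [(m <= k)%N]leqNgt km /= mul0r.
rewrite (@big_ord_shrink n m (fun j => j <= k)%N f); last 2 first.
- lia.
- by move=> j _ mj jk; lia.
have -> : (n - k.+1)%N = m by lia.
rewrite perturbationE// big_ord_recr/= Qentry_diag0 mul0r addr0 mulr_sumr.
apply: eq_big => j; first by have := ltn_ord j; lia.
move=> _; rewrite /f km1 eqxx ltn_ord /= /deriv_repr ltn_ord orbT exprS; ring.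
Qed.

(** Up to order m, the ordinary derivative of a quasi-derivative is the next u_j. *)
Lemma deriv_reprE (k : 'I_n) x : (k < m)%N ->
  Y k.+1 x + \sum_(j < n | (j <= k)%N) Fmatrix n I Sigma x k j * Y j x =
  deriv_repr k.+1 x.
Proof.
move=> km; rewrite row_identity /deriv_repr.
case: ifPn => km1.
  by rewrite perturbation0 ?mulr0 ?addr0//; lia.
have -> : (n - k.+1)%N = m by lia.
have -> : k.+1 = m by lia.
rewrite perturbationE// big_ord_recr/= Qentry_diag0 mul0r addr0; congr (_ + _).
rewrite mulNr; congr (- (_ * _)); apply: eq_bigr => j _.
by rewrite /deriv_repr ltn_ord orbT.
Qed.

End perturbations.
End quasi_derivatives.

(** * The differential expression as a function *)

Section expression.
Local Open Scope complex_scope.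
Context {R : realType}.
Context (n : nat) (I : nat -> nat) (Sigma : nat -> R -> R[i]).
Context (n2 : (2 <= n)%N) (hI : singularity_orders n I)
  (hS : Sigma_loc n I Sigma).
Local Notation m := n./2.
Context (y : R -> R[i]) (Y : nat -> R -> R[i]).
Context (hY : AC_quasi_derivatives (Fmatrix n I Sigma) y Y).
Implicit Types (nu s k j r : nat) (x : R) (phi : R -> R[i]).

Local Notation u := (deriv_repr n I Sigma Y).
Local Notation V := (perturbation n I Sigma Y).

Lemma half_lt_n : (m < n)%N. Proof. by have := m_gt0 n2; lia. Qed.

Lemma quasi_derivative_AC k : (k < n)%N -> AC_loc (Y k).
Proof. by case: hY => _ _; apply. Qed.

Lemma deriv_repr_AC j : (j <= m)%N -> odd n || (j < m)%N -> AC_loc (u j).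
Proof.
move=> jm jn; rewrite (_ : u j = Y j); first by apply: quasi_derivative_AC; lia.
by apply/funext => x; rewrite /deriv_repr jn.
Qed.

Lemma deriv_repr_topE : ~~ odd n -> u m = (fun x => Y m x +
  (- (-1) ^+ m) * \sum_(i < m) Qentry n I Sigma x i m * Y i x).
Proof.
by move=> on; apply/funext => x; rewrite /deriv_repr (negbTE on) ltnn /= mulNr.
Qed.

Lemma Qentry_sumE i : (i < m)%N -> (fun x => Qentry n I Sigma x i m) =
  (fun x => \sum_(nu < n.-1) \sum_(s < (leibniz_order I nu).+1 |
     (i == s + nu./2)%N && (m == leibniz_order I nu - s + nu./2)%N)
    leibniz_coef I nu s * Sigma nu x).
Proof. by move=> im; apply/funext => x; rewrite QentryE// ltnW. Qed.

(** The entries q_{j,m} only involve coefficients with nu in K(I): the column index m forces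
    s = 0 and equality in [leibniz_order_le]. *)
Lemma deriv_repr_top_L2 : ~~ odd n -> L2_loc (u m).
Proof.
move=> on; rewrite (deriv_repr_topE on); apply: L2_locD.
  exact/AC_loc_L2/quasi_derivative_AC/half_lt_n.
apply: L2_locZ; apply: L2_loc_sum => i _.
apply: (@L2_locM_AC _ (fun x => Qentry n I Sigma x i m) (Y i)); last first.
  by apply: quasi_derivative_AC; apply: ltn_trans (ltn_ord i) half_lt_n.
rewrite Qentry_sumE//; apply: L2_loc_sum => nu _; apply: L2_loc_sum => s /andP[/eqP h1 /eqP h2].
apply: L2_locZ; have [_] := hS (ltn_ord nu); apply.
apply: (in_KP n2) => //; have := leibniz_order_le n2 hI (ltn_ord nu); have := ltn_ord s; lia.
Qed.

Lemma deriv_repr_L1 j : (j <= m)%N -> L1_loc (u j).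
Proof.
move=> jm; have [jn|] := boolP (odd n || (j < m)%N).
  exact/AC_loc_L1/deriv_repr_AC.
rewrite negb_or -leqNgt => /andP[on mj]; have -> : j = m by lia.
rewrite (deriv_repr_topE on); apply: L1_locD.
  exact/AC_loc_L1/quasi_derivative_AC/half_lt_n.
apply: L1_locZ; apply: L1_loc_sum => i _.
apply: (@L1_locM_AC _ (fun x => Qentry n I Sigma x i m) (Y i)); last first.
  by apply: quasi_derivative_AC; apply: ltn_trans (ltn_ord i) half_lt_n.
rewrite Qentry_sumE//; apply: L1_loc_sum => nu _; apply: L1_loc_sum => s _.
by apply: L1_locZ; have [] := hS (ltn_ord nu).
Qed.

(** The only u_j that may fail to be locally absolutely continuous is u_m for even n; in a
    product with u_m equality holds in [leibniz_order_le], hence nu is in K(I) and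
    both factors are locally square integrable. *)
Lemma coef_deriv_L1 nu s : (nu < n.-1)%N -> (s <= leibniz_order I nu)%N ->
  L1_loc (fun x => Sigma nu x * u (s + nu./2)%N x).
Proof.
move=> nun st; have [S1 S2] := hS nun; have := leibniz_order_le n2 hI nun => le_m.
have [jn|] := boolP (odd n || (s + nu./2 < m)%N).
  by apply: L1_locM_AC => //; apply: deriv_repr_AC => //; lia.
rewrite negb_or -leqNgt => /andP[on mj].
apply: L1_locM_L2; first by apply: S2; apply: (in_KP n2) => //; lia.
have -> : (s + nu./2)%N = m by lia.
exact: deriv_repr_top_L2.
Qed.

Lemma perturbation_L1 r : L1_loc (V r).
Proof.
apply: L1_loc_sum => nu _; apply: L1_loc_sum => s _; apply: L1_locZ.
by apply: coef_deriv_L1; [exact: ltn_ord|rewrite -ltnS; exact: ltn_ord].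
Qed.

Lemma regular_perturbation r phi : test_function phi -> regular (V r) phi =
  \sum_(nu < n.-1) \sum_(s < (leibniz_order I nu).+1 | (r == leibniz_order I nu - s + nu./2)%N)
    leibniz_coef I nu s * regular (fun x => Sigma nu x * u (s + nu./2)%N x) phi.
Proof.
move=> tphi.
have L1 (nu : 'I_n.-1) (s : 'I_(leibniz_order I nu).+1) :
    L1_loc (fun x => Sigma nu x * u (s + nu./2)%N x).
  by apply: coef_deriv_L1; [exact: ltn_ord|rewrite -ltnS; exact: ltn_ord].
rewrite regular_sum//; last first.
  by move=> nu _; apply: L1_loc_sum => s _; apply: L1_locZ; exact: L1.
apply: eq_bigr => nu _; rewrite regular_sum//; last by move=> s _; apply: L1_locZ; exact: L1.
by apply: eq_bigr => s _; rewrite regularZ//; exact: L1.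
Qed.

(** The recursion that defines the quasi-derivatives, read as a statement on
    distributional derivatives. *)
Lemma quasi_derivative_step (k : 'I_n) : exists rho, [/\ L1_loc rho,
  {ae (@lebesgue_measure R), forall x, 0 < x ->
     rho x = Y k.+1 x + \sum_(j < n | (j <= k)%N) Fmatrix n I Sigma x k j * Y j x} &
  forall phi, test_function phi -> regular (Y k) (cderive 1 phi) = - regular rho phi].
Proof.
have [rho [L1 rhoE ibp]] := AC_loc_density (quasi_derivative_AC (ltn_ord k)).
exists rho; split => //; case: hY => _ hk _.
apply: ae_mono (ae_and rhoE (hk k)) => x [h1 h2] x0.
by rewrite (h1 x0) (h2 x0) subrK.
Qed.

Lemma has_density_deriv_repr j : (j <= m)%N ->
  has_density (dist_derive j (regular y)) (u j).
Proof.
have [Y0 _ _] := hY.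
elim: j => [|j ih] jm.
  split; first exact: deriv_repr_L1.
  move=> phi tphi; rewrite /dist_derive mul1r.
  rewrite (_ : cderive 0 phi = phi); last first.
    by apply/funext => x; rewrite /cderive /ReF /ImF /=; case: (phi x).
  by rewrite (_ : u 0%N = y)//; apply/funext => x; rewrite /deriv_repr (m_gt0 n2) orbT Y0.
split; first exact: deriv_repr_L1.
move=> phi tphi; have [_ H] := ih (ltnW jm).
have jn : (j < n)%N by apply: ltn_trans jm half_lt_n.
have [rho [L1 rhoE ibp]] := quasi_derivative_step (Ordinal jn).
have -> : regular (u j.+1) phi = regular rho phi.
  apply: regular_ae => //; [exact/L1_loc_measurable/deriv_repr_L1|exact: L1_loc_measurable|].
  apply: ae_mono rhoE => x h x0; rewrite (h x0).
  by have /esym := @deriv_reprE _ n I Sigma n2 hI Y (Ordinal jn) x jm.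
have tphi1 := test_cderive 1 tphi.
have ujE : u j = Y j by apply/funext => x; rewrite /deriv_repr jm orbT.
have := ibp _ tphi; rewrite /= -ujE -(H _ tphi1) /dist_derive cderiveD addn1 => h.
by rewrite /dist_derive exprS mulN1r mulNr h opprK.
Qed.

Lemma leibniz_term nu s phi : (nu < n.-1)%N -> (s <= leibniz_order I nu)%N -> test_function phi ->
  dist_derive (leibniz_order I nu - s + nu./2)
    (dist_mul (Sigma nu) (dist_derive (s + nu./2) (regular y))) phi =
  (-1) ^+ (leibniz_order I nu - s + nu./2) *
    regular (fun x => Sigma nu x * u (s + nu./2)%N x)
      (cderive (leibniz_order I nu - s + nu./2) phi).
Proof.
move=> nun st tphi; rewrite /dist_derive; congr (_ * _).
rewrite (@dist_mulE _ _ _ (u (s + nu./2)%N))//.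
- by apply: L1_loc_measurable; have [] := hS nun.
- by apply: has_density_deriv_repr; have := leibniz_order_le n2 hI nun; lia.
- exact: test_cderive.
Qed.

Lemma sum_parity (N : nat) (f : nat -> R[i]) :
  \sum_(nu < N) f nu = \sum_(k < uphalf N) f k.*2 + \sum_(k < N./2) f k.*2.+1.
Proof.
elim: N => [|N ih]; first by rewrite !big_ord0 addr0.
rewrite big_ord_recr /= ih uphalf_half; case: (boolP (odd N)) => oN.
  rewrite add1n -addrA; congr (_ + _); rewrite [RHS]big_ord_recr /=; congr (_ + f _).
  by lia.
rewrite add0n [X in _ = X + _]big_ord_recr /= addrAC; congr (_ + f _ + _).
by lia.
Qed.

(** The signs cancel: (-1)^(t+k) from the expression, (-1)^s from the Leibniz rule and
    (-1)^(t-s+k) from the distributional derivative, where t is [leibniz_order] and k the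
    half of nu, multiply to 1. *)
Lemma ellE phi : test_function phi -> ell n I Sigma y phi =
  (-1) ^+ n * regular y (cderive n phi) +
  \sum_(nu < n.-1) \sum_(s < (leibniz_order I nu).+1)
    leibniz_coef I nu s * regular (fun x => Sigma nu x * u (s + nu./2)%N x)
      (cderive (leibniz_order I nu - s + nu./2) phi).
Proof.
move=> tphi; pose f nu := \sum_(s < (leibniz_order I nu).+1)
    leibniz_coef I nu s * regular (fun x => Sigma nu x * u (s + nu./2)%N x)
      (cderive (leibniz_order I nu - s + nu./2) phi).
have fE nu : (nu < n.-1)%N -> f nu = (-1) ^+ (leibniz_order I nu + nu./2) *
    \sum_(s < (leibniz_order I nu).+1) (-1) ^+ s * leibniz_coef I nu s *
    dist_derive (leibniz_order I nu - s + nu./2)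
    (dist_mul (Sigma nu) (dist_derive (s + nu./2) (regular y))) phi.
  move=> nun; rewrite mulr_sumr; apply: eq_bigr => s _.
  have st : (s <= leibniz_order I nu)%N by rewrite -ltnS.
  rewrite leibniz_term//.
  have sgn : (-1) ^+ (leibniz_order I nu + nu./2) * (-1) ^+ s *
      (-1) ^+ (leibniz_order I nu - s + nu./2) = 1 :> R[i].
    rewrite -2!exprD.
    have -> : ((leibniz_order I nu + nu./2) + s + (leibniz_order I nu - s + nu./2) =
        (leibniz_order I nu + nu./2).*2)%N by lia.
    by rewrite -mul2n exprM sqrrN expr1n expr1n.
  by rewrite -[LHS]mul1r -[X in X * _ = _]sgn; ring.
rewrite (sum_parity _ f) /ell -addrA; congr (_ + (_ + _)).
  have -> : uphalf n.-1 = m by lia.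
  apply: eq_bigr => k _; rewrite fE; last by have := ltn_ord k; lia.
  by rewrite /leibniz_order /leibniz_coef odd_double /= addn0 doubleK.
have -> : n.-1./2 = (m + odd n).-1 by have := odd_double_half n; lia.
apply: eq_bigr => k _; rewrite fE; last by have := ltn_ord k; have := odd_double_half n; lia.
by rewrite /leibniz_order /leibniz_coef /= odd_double /= addn1 uphalf_double addn1 addSn.
Qed.

(** Horner scheme: after d steps, (-1)^d y^[n-d] is paired with the d-th derivative of the
    test function, and the terms V_r with r < d have been split off. *)
Lemma ell_has_density : exists g, has_density (ell n I Sigma y) g /\
  ae_eq_on_Rplus g (Y n).
Proof.
have [Y0 _ _] := hY.
have nn1 : (n.-1 < n)%N by lia.
have [rho [Lrho rhoE _]] := quasi_derivative_step (Ordinal nn1).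
(* A representative of y^[n] that is measurable, unlike an arbitrary one. *)
pose g x := rho x + V 0%N x.
have Lg : L1_loc g by apply: L1_locD => //; exact: perturbation_L1.
have gY : ae_eq_on_Rplus g (Y n).
  apply: ae_mono rhoE => x h x0; rewrite /g (h x0) row_identity//.
  have -> /= : n.-1.+1 = n by lia.
  by rewrite subnn expr0 mulN1r subrK.
(* Locally integrable representatives of all quasi-derivatives. *)
pose Z k := if (k < n)%N then Y k else g.
have LZ k : L1_loc (Z k).
  by rewrite /Z; case: ifP => // kn; apply: AC_loc_L1; exact: quasi_derivative_AC.
have ZY k : (k <= n)%N -> ae_eq_on_Rplus (Z k) (Y k).
  move=> kn; rewrite /Z; case: ltnP => [_|nk]; first exact: nearW.
  by have -> : k = n by lia.
exists g; split => //; split => // phi tphi.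
have step d : (d <= n)%N -> regular g phi =
    (-1) ^+ d * regular (Z (n - d)%N) (cderive d phi) +
    \sum_(r < d) regular (V r) (cderive r phi).
  elim: d => [|d ih] dn.
    rewrite big_ord0 addr0 mul1r subn0 /Z ltnn; congr regular.
    by apply/funext => x; rewrite /cderive /ReF /ImF /=; case: (phi x).
  rewrite ih; last exact: ltnW.
  rewrite big_ord_recr /= [RHS]addrA addrAC; congr (_ + _).
  have kn : (n - d.+1 < n)%N by lia.
  have [r [Lr rE ibp]] := quasi_derivative_step (Ordinal kn).
  have tphid := test_cderive d tphi.
  have kE : (n - d.+1).+1 = (n - d)%N by lia.
  have -> : regular (Z (n - d)%N) (cderive d phi) =
      regular (fun x => r x + (-1) ^+ d * V d x) (cderive d phi).
    apply: regular_ae => //.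
    - exact: L1_loc_measurable.
    - by apply: L1_loc_measurable; apply: L1_locD => //; apply: L1_locZ; exact: perturbation_L1.
    - apply: ae_mono (ae_and rE (ZY (n - d)%N (leq_subr _ _))) => x [h1 h2] x0.
      rewrite (h2 x0) (h1 x0) row_identity//= kE.
      have -> : (n - (n - d) = d)%N by lia.
      by rewrite mulNr subrK.
  have Lp := perturbation_L1 d.
  rewrite regularD//; last exact: L1_locZ.
  rewrite regularZ// mulrDr mulrA -exprD addnn -mul2n exprM sqrrN expr1n expr1n mul1r.
  congr (_ + _); have := ibp _ tphid; rewrite cderiveD add1n /= => h.
  by rewrite /Z kn h exprS; ring.
rewrite (step n)// ellE// subnn {1}/Z ifT; last by lia.
rewrite Y0; congr (_ + _).
under [RHS]eq_bigr => r _ do rewrite (regular_perturbation r (test_cderive r tphi)).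
rewrite [RHS]exchange_big /=; apply: eq_bigr => nu _.
rewrite (exchange_big_dep xpredT)//=; apply: eq_bigr => s _.
have rn : (leibniz_order I nu - s + nu./2 < n)%N.
  by have := leibniz_order_le n2 hI (ltn_ord nu); have := half_lt_n; lia.
by rewrite (big_pred1 (Ordinal rn)) //= => r; rewrite -val_eqE.
Qed.

End expression.

Theorem theorem2p2 (R : realType) (n : nat) (I : nat -> nat)
    (Sigma : nat -> R -> R[i]) :
  (2 <= n)%N -> singularity_orders n I -> Sigma_loc n I Sigma ->
  forall y : R -> R[i], domain (Fmatrix n I Sigma) y ->
  exists g : R -> R[i],
    has_density (ell n I Sigma y) g /\
    forall Y : nat -> R -> R[i],
      AC_quasi_derivatives (Fmatrix n I Sigma) y Y -> ae_eq_on_Rplus g (Y n).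
Proof.
move=> n2 hI hS y [Y0 hY0].
have [g [Tg _]] := ell_has_density n2 hI hS hY0.
exists g; split => // Y hY; have [g' [Tg' g'Y]] := ell_has_density n2 hI hS hY.
by apply: ae_mono (ae_and (has_density_unique Tg Tg') g'Y) => x [h1 h2] x0; rewrite h1// h2.
Qed.
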